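(* Let $d\ge1$ be an integer, let $1<p,s<\infty$ and $0<\alpha<d+1$ with $\frac1s+\frac1p+\frac{\alpha}{d+1}\le2$, and let $C_2$ be the best (smallest) constant $C$ such that $$\left|\int_{\mathbb{B}^d}\int_{\mathbb{B}^d}\frac{f(w)g(z)}{|1-\langle z,w\rangle|^\alpha}\,dv(w)\,dv(z)\right|\le C\,\|f\|_{L^p}\|g\|_{L^s}\quad\text{for all } f\in L^p(\mathbb{B}^d),\ g\in L^s(\mathbb{B}^d).$$ Then the following hold. (1) If $\frac1p<1-\frac1s$, then $$C_2\le\frac{\Gamma(d+1)\,\Gamma(d+1-\alpha)}{\Gamma^2\!\left(d+1-\frac{\alpha}{2}\right)}.$$ (2) If $\frac1p-\left(1-\frac{\alpha}{d+1}\right)<1-\frac1s\le\frac1p$, then $$C_2\le\left(\frac{\Gamma(d+1)\,\Gamma\!\left(d+1-\frac{\alpha}{2-p^{-1}-s^{-1}}\right)}{\Gamma^2\!\left(d+1-\frac{\alpha}{2(2-p^{-1}-s^{-1})}\right)}\right)^{2-\frac1p-\frac1s}.$$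
   Context: $\mathbb{B}^d$ is the open unit ball of $\mathbb{C}^d$ with Lebesgue measure $dv$ normalized so that $v(\mathbb{B}^d)=1$; $\langle z,w\rangle=\sum_j z_j\overline{w_j}$; $L^p(\mathbb{B}^d)=L^p(\mathbb{B}^d,dv)$. $\Gamma$ is the Gamma function. *)

(* Defs.v *)
From HB Require Import structures.
From mathcomp Require Import all_boot all_order all_algebra.
From mathcomp Require Import complex.
From mathcomp Require Import all_classical all_reals all_analysis.
From mathcomp Require Import measurable_realfun.

Set Implicit Arguments.
Unset Strict Implicit.
Unset Printing Implicit Defensive.

Import Order.TTheory GRing.Theory Num.Theory.
Import numFieldNormedType.Exports.

Local Open Scope classical_set_scope.
Local Open Scope ring_scope.
Local Open Scope complex_scope.

Notation normc := Normc.normc.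

Definition complex_of_pair (R : realType) (p : R * R) : R[i] := p.1 +i* p.2.

Definition pair_of_complex (R : realType) (z : R[i]) : R * R :=
  (complex.Re z, complex.Im z).

Lemma complex_of_pairK (R : realType) :
  cancel (@complex_of_pair R) (@pair_of_complex R).
Proof. by case. Qed.

Lemma pair_of_complexK (R : realType) :
  cancel (@pair_of_complex R) (@complex_of_pair R).
Proof. by case. Qed.

Fact complex_display : measure_display. Proof. exact: default_measure_display. Qed.

(* The Borel sigma-algebra of [R[i]], transported from [R * R]. *)
Section complex_measurable.
Variable R : realType.

Definition complex_measurable : set (set R[i]) :=
  preimage_set_system setT (@pair_of_complex R) measurable.

Let sigma_complex : sigma_algebra setT complex_measurable.
Proof. by apply: sigma_algebra_preimage; exact: sigma_algebra_measurable. Qed.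

Let complex_measurable0 : complex_measurable set0.
Proof. by case: sigma_complex. Qed.

Let complex_measurableC A : complex_measurable A -> complex_measurable (~` A).
Proof. by case: sigma_complex => _ + _ mA => /(_ A mA); rewrite setTD. Qed.

Let complex_measurable_bigcup (F : (set R[i])^nat) :
  (forall i, complex_measurable (F i)) -> complex_measurable (\bigcup_i F i).
Proof. by case: sigma_complex => _ _ /(_ F). Qed.

HB.instance Definition _ := isPointed.Build R[i] 0.
HB.instance Definition _ := @isMeasurable.Build complex_display R[i]
  complex_measurable complex_measurable0 complex_measurableC
  complex_measurable_bigcup.

End complex_measurable.

Lemma measurable_pair_of_complex (R : realType) :
  measurable_fun setT (@pair_of_complex R).
Proof. by move=> _ A mA; exists A. Qed.

(* [lebesgue_measure] lives on [measurableTypeR R], which carries the same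
   sigma-algebra as [R] under another display. *)
Lemma measurable_pair_of_complexTypeR (R : realType) :
  measurable_fun setT
    (@pair_of_complex R : R[i] -> measurableTypeR R * measurableTypeR R).
Proof. exact: measurable_pair_of_complex. Qed.

Lemma measurable_complex_of_pair (R : realType) :
  measurable_fun setT
    (@complex_of_pair R : measurableTypeR R * measurableTypeR R -> R[i]).
Proof.
move=> _ _ [B mB <-]; rewrite !setTI -comp_preimage.
by rewrite (_ : _ \o _ = id)//; apply/funext => -[].
Qed.

(* The image of the product of two sigma-finite measures by a measurable map
   with a measurable retraction; the retraction ensures sigma-finiteness. *)
Section image_product.
Context d1 d2 d (T1 : measurableType d1) (T2 : measurableType d2)
  (T : measurableType d) (R : realType).
Variables (m1 : {sigma_finite_measure set T1 -> \bar R})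
  (m2 : {sigma_finite_measure set T2 -> \bar R}).
Variables (f : T1 * T2 -> T) (g : T -> T1 * T2).
Hypotheses (mf : measurable_fun setT f) (mg : measurable_fun setT g).
Hypothesis fK : cancel f g.

Definition image_product of measurable_fun setT f & measurable_fun setT g &
  cancel f g : set T -> \bar R := pushforward (m1 \x m2)%E f.

Local Notation im := (image_product mf mg fK).

Let im0 : im set0 = 0%E.
Proof. by rewrite /image_product /pushforward preimage_set0 measure0. Qed.

Let im_ge0 A : (0 <= im A)%E. Proof. exact: measure_ge0. Qed.

Let im_sigma_additive : semi_sigma_additive im.
Proof.
exact: (@measure_semi_sigma_additive _ _ _
  (measure_function_pushforward__canonical__measure_function_Measure
     (m1 \x m2)%E mf)).
Qed.

HB.instance Definition _ := isMeasure.Build _ _ _ im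
  im0 im_ge0 im_sigma_additive.

Let im_sigma_finite : sigma_finite setT im.
Proof.
have /sigma_finiteP[F [TF ndF Foo]] := sigma_finiteT m1.
have /sigma_finiteP[G [TG ndG Goo]] := sigma_finiteT m2.
exists (fun n => g @^-1` (F n `*` G n)).
  rewrite -preimage_bigcup -[LHS](@preimage_setT _ _ g); congr (_ @^-1` _).
  rewrite -setXTT TF TG predeqE => -[x y]; split.
    move=> [/= [n _ Fnx] [k _ Gky]]; exists (maxn n k) => //; split.
    - by move: x Fnx; exact/subsetPset/ndF/leq_maxl.
    - by move: y Gky; exact/subsetPset/ndG/leq_maxr.
  by move=> [n _ []/= ? ?]; split; exists n.
move=> k; have [? ?] := Foo k; have [? ?] := Goo k.
have mFG : measurable (F k `*` G k) by exact: measurableX.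
split; first by rewrite -[X in measurable X]setTI; exact: mg.
rewrite /image_product /pushforward -comp_preimage (_ : g \o f = id).
  by rewrite preimage_id product_measure1E// lte_mul_pinfty// ge0_fin_numE.
exact/funext.
Qed.

HB.instance Definition _ := Measure_isSigmaFinite.Build _ _ _ im im_sigma_finite.

End image_product.

Definition lebesgue_complex (R : realType) :
    {sigma_finite_measure set R[i] -> \bar R} :=
  image_product lebesgue_measure lebesgue_measure
    (@measurable_complex_of_pair R) (@measurable_pair_of_complexTypeR R)
    (@complex_of_pairK R).

Section tuple_power.
Context d (T : measurableType d) (R : realType).
Variable mu : {sigma_finite_measure set T -> \bar R}.

Definition tuple_of_pair n (x : T * n.-tuple T) : n.+1.-tuple T :=
  [tuple of x.1 :: x.2].

Definition pair_of_tuple n (t : n.+1.-tuple T) : T * n.-tuple T :=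
  (thead t, [tuple of behead t]).

Lemma tuple_of_pairK n : cancel (@tuple_of_pair n) (@pair_of_tuple n).
Proof. by case=> x t; congr pair; exact/val_inj. Qed.

Lemma measurable_tuple_of_pair n : measurable_fun setT (@tuple_of_pair n).
Proof. exact: measurable_cons. Qed.

Lemma measurable_pair_of_tuple n : measurable_fun setT (@pair_of_tuple n).
Proof.
apply: measurable_fun_pair; first exact: measurable_tnth.
exact: measurable_behead.
Qed.

Fixpoint power_measure n : {sigma_finite_measure set n.-tuple T -> \bar R} :=
  if n is k.+1 then
    image_product mu (power_measure k) (@measurable_tuple_of_pair k)
      (@measurable_pair_of_tuple k) (@tuple_of_pairK k)
  else dirac [tuple].

End tuple_power.

Section ball.
Variables (R : realType) (d : nat).

Definition Cn := d.-tuple R[i].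

Definition dotC (z w : Cn) : R[i] := \sum_(j < d) tnth z j * (tnth w j)^*.

Definition unit_ball : set Cn :=
  [set z | \sum_(j < d) normc (tnth z j) ^+ 2 < 1].

Definition lebesgue_Cn : {sigma_finite_measure set Cn -> \bar R} :=
  power_measure (lebesgue_complex R) d.

Lemma measurable_unit_ball : measurable unit_ball.
Proof.
pose q (z : Cn) : R := \sum_(j < d) normc (tnth z j) ^+ 2.
suff mq : measurable_fun setT q.
  rewrite -[X in measurable X]setTI.
  rewrite (_ : unit_ball = q @^-1` `]-oo, 1[%classic); first exact: mq.
  by apply/seteqP; split => z /=; rewrite in_itv.
apply: measurable_sum => j.
have mn : measurable_fun setT (fun x : R[i] => normc x ^+ 2).
  rewrite (_ : (fun _ => _) =
    (fun p : R * R => p.1 ^+ 2 + p.2 ^+ 2) \o @pair_of_complex R).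
    apply: measurableT_comp; last exact: measurable_pair_of_complex.
    by apply: measurable_funD; apply: measurable_funX; [exact: measurable_fst|exact: measurable_snd].
  by apply/funext => -[a b] /=; rewrite sqr_sqrtr// addr_ge0// sqr_ge0.
by apply: (measurableT_comp mn); exact: measurable_tnth.
Qed.

Fact ball_scale_ge0 : 0 <= (fine (lebesgue_Cn unit_ball))^-1.
Proof. by rewrite invr_ge0 fine_ge0. Qed.

(* dv, regarded as a measure on C^d carried by the unit ball. *)
Definition dv : {measure set Cn -> \bar R} :=
  mscale (NngNum ball_scale_ge0) (mrestr lebesgue_Cn measurable_unit_ball).

(* A function on the ball is represented by a function on C^d; its values
   outside the ball are irrelevant since [dv] is carried by the ball. *)
Definition Lp (p : R) : set (Cn -> R[i]) :=
  [set f | measurable_fun setT f /\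
           ('N[dv]_p%:E[EFin \o (@normc R \o f)] < +oo)%E].

Definition normLp (p : R) (f : Cn -> R[i]) : R :=
  fine 'N[dv]_p%:E[EFin \o (@normc R \o f)]%E.

Definition Cintegral (h : Cn -> R[i]) : R[i] :=
  (\int[dv]_(z in unit_ball) complex.Re (h z)) +i*
  (\int[dv]_(z in unit_ball) complex.Im (h z)).

Definition kernel_form (alpha : R) (f g : Cn -> R[i]) (w z : Cn) : R[i] :=
  f w * g z / (normc (1 - dotC z w) `^ alpha)%:C.

(* [C] is admissible when for all [f] and [g] the double integral converges
   absolutely and satisfies the inequality; without absolute convergence,
   [Cintegral] would only be a conventional value. *)
Definition admissible (alpha p s C : R) : Prop :=
  forall f g : Cn -> R[i], Lp p f -> Lp s g ->
    (\int[dv]_(z in unit_ball) \int[dv]_(w in unit_ball)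
       (normc (kernel_form alpha f g w z))%:E < +oo)%E /\
    normc (Cintegral (fun z => Cintegral (fun w => kernel_form alpha f g w z)))
      <= C * normLp p f * normLp s g.

(* The infimum is [+oo] when there is no admissible constant, and it is attained
   otherwise. *)
Definition best_constant (alpha p s : R) : \bar R :=
  ereal_inf [set C%:E | C in admissible alpha p s].

End ball.

Definition Gamma (R : realType) (x : R) : R :=
  \int[lebesgue_measure]_(t in `]0, +oo[%classic) (t `^ (x - 1) * expR (- t)).

(* Main.v *)
(* Both bounds are Young's convolution inequality for a kernel K whose integral in
   each variable is at most 1 after scaling.  With t = 2 - 1/p - 1/s and K equal to
   |1 - <z,w>|^(-alpha/t) up to scaling, it is obtained by integrating the weighted
   AM-GM inequality
     |f g| K^t <= (1 - 1/s) |f|^p K + (1 - 1/p) |g|^s K + (1/p + 1/s - 1) |f|^p |g|^s,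
   where f and g have norm 1.  When 1/p + 1/s < 1, take K = |1 - <z,w>|^(-alpha) up
   to scaling and multiply |f g| <= |f|^p / p + |g|^s / s + (1 - 1/p - 1/s) by K.

   What remains is the bound of the integral over w of |1 - <z,w>|^(-2b) by
   Gamma(d+1) Gamma(d+1-2b) / Gamma(d+1-b)^2, uniformly in z.  The integrand is
   the limit of |P_N(<z,w>)|^2, where P_N is a partial sum of the binomial series
   of (1 - x)^(-b); by orthogonality the integral of |P_N(<z,w>)|^2 is at most a
   partial sum of the hypergeometric series F(b, b; d+1; 1), and Fatou's lemma
   reduces the claim to one half of Gauss' summation theorem. *)
Require Import Defs.
From HB Require Import structures.
From mathcomp Require Import all_boot all_order all_algebra.
From mathcomp Require Import cyclic separable cyclotomic complex.
From mathcomp Require Import all_classical all_reals all_analysis.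
From mathcomp Require Import measurable_realfun ring lra.

Set Implicit Arguments.
Unset Strict Implicit.
Unset Printing Implicit Defensive.

Import Order.TTheory GRing.Theory Num.Theory.
Import numFieldNormedType.Exports.

Local Open Scope classical_set_scope.
Local Open Scope complex_scope.
Local Open Scope ring_scope.

(** * Gauss summation and the Gamma function *)

(** In case (2) the weights of the AM-GM inequality are forced: the powers of |f|^p must multiply to
    |f| and those of |g|^s to |g|, which leaves K with exponent (1 - 1/s) + (1 - 1/p) = t. The
    hypothesis of (2) rearranges to alpha/t < d + 1, which keeps d + 1 - alpha/t, an argument of
    Gamma, positive.

    Neither complex powers nor polar coordinates in C^d are used. Only |1 - x|^(-2b) has to be
    reached by the partial sums, and a real-variable argument on the segment from 0 to x does this
    through the differential equation of the binomial series. The moments over the ball are found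
    one coordinate at a time, from the invariance of plane measure under rotations and the
    proportionality of the area of a disc to its squared radius.

    For Gauss' theorem, G(c) = Gamma(c) Gamma(c - 2b) / Gamma(c - b)^2 satisfies exactly the
    recursion from c to c + 1 that partial sums of F(b, b; c; 1) satisfy as an inequality.
    Log-convexity gives G >= 1 while the partial sums are asymptotically at most 1 for large c, so
    the comparison propagates down to c. *)

Section gauss.
Variable R : realType.
Implicit Types b c : R.

(** The term (b)_k^2 / (k! (c)_k) of the series F(b, b; c; 1), with rising factorials (b)_k. *)
Definition gauss_term b c (k : nat) : R :=
  \prod_(i < k) ((b + i%:R) ^+ 2 / (i.+1%:R * (c + i%:R))).

Definition gauss_sum b c (n : nat) : R := \sum_(k < n) gauss_term b c k.

Lemma gauss_term_ge0 b c k : 0 < c -> 0 <= gauss_term b c k.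
Proof.
move=> c0; apply: prodr_ge0 => i _.
by rewrite divr_ge0 ?sqr_ge0// mulr_ge0// addr_ge0// ltW.
Qed.

Lemma gauss_termS b c k : gauss_term b c k.+1 =
  gauss_term b c k * ((b + k%:R) ^+ 2 / (k.+1%:R * (c + k%:R))).
Proof. by rewrite /gauss_term big_ord_recr. Qed.

Lemma gauss_term_shift b c k : 0 < c ->
  gauss_term b (c + 1) k * (c + k%:R) = c * gauss_term b c k.
Proof.
move=> c0; elim: k => [|k ih]; first by rewrite /gauss_term !big_ord0; ring.
have ck : c + k%:R != 0 by rewrite gt_eqF// ltr_wpDr.
have ck1 : c + 1 + k%:R != 0 by rewrite gt_eqF// ltr_wpDr// addr_gt0.
have k1 : k%:R + 1 != 0 :> R by rewrite natr1 pnatr_eq0.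
rewrite !gauss_termS [RHS]mulrA -ih -natr1; field; rewrite k1 ck.
by rewrite (_ : c + 1 + k%:R != 0).
Qed.

(* For the full series, this is the contiguity relation between F(b,b;c;1) and
   F(b,b;c+1;1); for partial sums, the boundary term is nonnegative. *)
Lemma gauss_sum_contiguous b c n : 0 < c ->
  c * (c - 2 * b) * gauss_sum b c n + c * n%:R * gauss_term b c n =
  (c - b) ^+ 2 * gauss_sum b (c + 1) n.
Proof.
move=> c0; elim: n => [|n ih]; first by rewrite /gauss_sum !big_ord0; ring.
have cn : c + n%:R != 0 by rewrite gt_eqF// ltr_wpDr.
have n1 : n%:R + 1 != 0 :> R by rewrite natr1 pnatr_eq0.
have -> : gauss_sum b c n.+1 = gauss_sum b c n + gauss_term b c n.
  by rewrite /gauss_sum big_ord_recr.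
have -> : gauss_sum b (c + 1) n.+1 = gauss_sum b (c + 1) n + gauss_term b (c + 1) n.
  by rewrite /gauss_sum big_ord_recr.
rewrite [in RHS]mulrDr -ih.
have -> : gauss_term b (c + 1) n = c * gauss_term b c n / (c + n%:R).
  by rewrite -gauss_term_shift// mulfK.
rewrite gauss_termS -natr1; field. by rewrite cn addrC.
Qed.

Lemma gauss_sum_step b c n : 0 < c ->
  c * (c - 2 * b) * gauss_sum b c n <= (c - b) ^+ 2 * gauss_sum b (c + 1) n.
Proof.
move=> c0; rewrite -gauss_sum_contiguous// lerDl.
by rewrite !mulr_ge0 ?gauss_term_ge0// ltW.
Qed.

Lemma gauss_sum_ge0 b c n : 0 < c -> 0 <= gauss_sum b c n.
Proof. by move=> c0; apply: sumr_ge0 => k _; exact: gauss_term_ge0. Qed.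

(** Raising c to c + N multiplies the factor i = 0 of each term with k >= 1 by c / (c + N) and does
    not increase the other factors; the term k = 0 is 1. *)
Lemma gauss_sum_large b c (N n : nat) : 0 < c ->
  gauss_sum b (c + N%:R) n <= 1 + c / (c + N%:R) * gauss_sum b c n.
Proof.
move=> c0; have cN : 0 < c + N%:R by rewrite ltr_wpDr.
have S0 : 0 <= c / (c + N%:R) by rewrite divr_ge0// ltW.
case: n => [|n].
  by rewrite /gauss_sum !big_ord0 mulr0 addr0.
rewrite /gauss_sum big_ord_recl {1}/gauss_term big_ord0 lerD2l.
rewrite [X in _ <= _ * X]big_ord_recl mulrDr.
apply: ler_wpDl; first by rewrite mulr_ge0 ?gauss_term_ge0.
rewrite mulr_sumr; apply: ler_sum => k _.
rewrite /gauss_term !big_ord_recl/= !addr0 mulrA.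
apply: ler_pM.
- by rewrite divr_ge0 ?sqr_ge0// mulr_ge0// ltW.
- apply: prodr_ge0 => i _.
  by rewrite divr_ge0 ?sqr_ge0// mulr_ge0// addr_ge0// ltW.
- rewrite (_ : c / _ * _ = b ^+ 2 / (1 * (c + N%:R)))//.
  by field; rewrite ?gt_eqF.
- apply: ler_prod => i _.
  apply/andP; split.
    by rewrite divr_ge0 ?sqr_ge0// mulr_ge0// addr_ge0// ltW.
  rewrite ler_wpM2l ?sqr_ge0// lef_pV2 ?posrE ?mulr_gt0// ?ltr_wpDr//.
  by rewrite ler_wpM2l// lerD2r lerDl.
Qed.

(* The ratio [gauss_sum / G] is nondecreasing along [c], [c + 1], ..., and the sum
   tends to 1 there. *)
Lemma gauss_sum_le (G : R -> R) b c n : 0 < b -> 2 * b < c ->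
  (forall x, 2 * b < x -> 1 <= G x) ->
  (forall x, 2 * b < x -> x * (x - 2 * b) * G x = (x - b) ^+ 2 * G (x + 1)) ->
  gauss_sum b c n <= G c.
Proof.
move=> b0 bc G1 GS.
have step N : gauss_sum b c n * G (c + N%:R) <= G c * gauss_sum b (c + N%:R) n.
  elim: N => [|N ih]; first by rewrite addr0 mulrC.
  set x := c + N%:R in ih *.
  have bx : 2 * b < x by rewrite ltr_wpDr.
  have x0 : 0 < x by lra.
  have xx : 0 < x * (x - 2 * b) by rewrite mulr_gt0// subr_gt0.
  have xb : 0 < (x - b) ^+ 2 by rewrite exprn_gt0//; lra.
  rewrite -natr1 addrA -/x -(ler_pM2l xb).
  rewrite mulrCA -GS// [leRHS]mulrCA.
  apply: (le_trans (y := x * (x - 2 * b) * (G c * gauss_sum b x n))).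
    by rewrite mulrCA ler_pM2l.
  rewrite [leLHS]mulrCA; apply: ler_wpM2l; last exact: gauss_sum_step.
  by rewrite (le_trans ler01)// G1.
have c0 : 0 < c by lra.
have S0 := gauss_sum_ge0 b n c0.
have le N : gauss_sum b c n <= G c * (1 + c / (c + N%:R) * gauss_sum b c n).
  apply: le_trans (le_trans (step N) _).
    by rewrite ler_peMr// G1// ltr_wpDr.
  by rewrite ler_wpM2l ?gauss_sum_large// (le_trans ler01)// G1.
(* Archimedean form of letting N tend to infinity in [le]: once N exceeds K / e, the error K / (c +
   N) is smaller than the supposed gap e. *)
rewrite leNgt; apply/negP => lt.
set S := gauss_sum b c n in lt le S0.
pose e := S - G c; have e0 : 0 < e by rewrite subr_gt0.
pose K := G c * c * S.
have := le (Num.truncn (K / e)).+1; apply/negP; rewrite -ltNge.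
set N := (Num.truncn (K / e)).+1.
have Gc : 1 <= G c by exact: G1.
have K0 : 0 <= K by rewrite /K !mulr_ge0//; lra.
have KN : K / e < N%:R by rewrite truncnS_gt.
have cN : 0 < c + N%:R by rewrite ltr_wpDr.
have -> : G c * (1 + c / (c + N%:R) * S) = G c + K / (c + N%:R).
  by rewrite /K; field; rewrite gt_eqF.
rewrite -ltrBrDl ltr_pdivrMr// -/e.
move: KN; rewrite ltr_pdivrMr// => KN; nra.
Qed.

End gauss.

(** * The Gamma function: functional equation, finiteness, positivity, log-convexity *)

Section gamma.
Variable R : realType.
Local Notation mu := (@lebesgue_measure R).
Local Notation RR := (measurableTypeR R).
Implicit Types x t u : R.

Lemma continuous_expRN : continuous (fun t : R => expR (- t)).
Proof.
move=> t; apply: continuous_comp; first exact: continuousN.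
exact: continuous_expR.
Qed.

Lemma is_derive_expRN t : is_derive t 1 (fun t : R => - expR (- t)) (expR (- t)).
Proof.
have d1 : is_derive (- t) 1 (@expR R) (expR (- t)) := is_derive_expR (- t).
have d2 : is_derive t 1 (fun t : R => - t) (-1) by exact: is_deriveN.
have := is_deriveN (is_derive1_comp d1 d2).
by rewrite ?mulN1r ?mulrN1 opprK.
Qed.

Lemma integral_expRN t :
  (\int[mu]_(u in `[t, +oo[) (expR (- u))%:E = (expR (- t))%:E)%E.
Proof.
rewrite (@ge0_continuous_FTC2y _ _ (fun u => - expR (- u)) _ 0).
- by rewrite sub0e EFinN oppeK.
- by move=> u _; exact: expR_ge0.
- exact/continuous_subspaceT/continuous_expRN.
- by rewrite -oppr0; apply: cvgN; exact: cvgr_expR.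
- by move=> u _; apply: ex_derive; exact: is_derive_expRN.
- apply: cvg_at_right_filter; apply: cvgN; exact: continuous_expRN.
- by move=> u _; rewrite derive1E; apply: derive_val; exact: is_derive_expRN.
Qed.

Lemma integral_powR x u : 0 < x -> 0 < u ->
  (\int[mu]_(t in `]0%R, u]) (x * t `^ (x - 1))%:E = (u `^ x)%:E)%E.
Proof.
move=> x0 u0.
(* Since x - 1 may be negative, the fundamental theorem of calculus is applied away from 0, followed
   by monotone convergence; n + 2 keeps the lower endpoint strictly below u. *)
pose F n := `[u / n.+2%:R, u]%classic.
pose f t : \bar R := (x * t `^ (x - 1))%:E.
have ug n : 0 < u / n.+2%:R by rewrite divr_gt0.
have UF : \bigcup_n F n = `]0, u]%classic.
  apply/seteqP; split => [t [n _]|t]; rewrite /F /= !in_itv/= => /andP[t0 tu].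
    by rewrite tu (lt_le_trans (ug n)).
  exists (Num.truncn (u / t)) => //=; rewrite in_itv/= tu andbT.
  rewrite ler_pdivrMr// mulrC -ler_pdivrMr// ltW// (lt_trans (truncnS_gt _))//.
  by rewrite ltr_nat.
have mf : measurable_fun setT (f : RR -> \bar R).
  by apply/measurable_EFinP; apply: measurable_funM => //; exact: measurable_powR.
have cF : (\int[mu]_(t in F n) f t @[n --> \oo] --> \int[mu]_(t in `]0%R, u]) f t)%E.
  rewrite -UF; apply: ge0_nondecreasing_set_cvg_integral.
  - move=> m n mn; rewrite subsetEset => t; rewrite /F/= !in_itv/= => /andP[t1 ->].
    by rewrite andbT (le_trans _ t1)// ler_pM2l// lef_pV2 ?posrE// ler_nat.
  - by move=> n; exact: measurable_itv.
  - by move=> n; exact: measurable_funTS.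
  - by move=> n t _; rewrite lee_fin mulr_ge0 ?powR_ge0// ltW.
have FE n : (\int[mu]_(t in F n) f t = (u `^ x - (u / n.+2%:R) `^ x)%:E)%E.
  have un : u / n.+2%:R < u.
    by rewrite ltr_pdivrMr// -[X in X < _]mulr1 ltr_pM2l// ltr1n.
  have dF (t a : R) : 0 < t -> is_derive t 1 (@powR R ^~ a) (a * t `^ (a - 1)).
    by move=> t0; exact: is_derive1_powR.
  have cP (t a : R) : 0 < t -> {for t, continuous (@powR R ^~ a)}.
    move=> t0; apply: differentiable_continuous; apply/derivable1_diffP.
    by apply: ex_derive; exact: dF.
  rewrite /F (@continuous_FTC2 _ _ (@powR R ^~ x))//.
  - move=> t; apply: continuous_in_subspaceT => {}t.
    rewrite inE/= in_itv/= => /andP[ut _]; have t0 := lt_le_trans (ug n) ut.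
    by apply: cvgM; [exact: cvg_cst|exact: cP].
  - split.
    + move=> t; rewrite in_itv/= => /andP[ut _].
      by apply: ex_derive; apply: dF; exact: lt_trans ut.
    + exact/cvg_at_right_filter/cP.
    + exact/cvg_at_left_filter/cP.
  - move=> t; rewrite in_itv/= => /andP[ut _]; rewrite derive1E.
    by apply: derive_val; apply: dF; exact: lt_trans ut.
have lim0 : (u / n.+2%:R) `^ x @[n --> \oo] --> (0 : R).
  move: (powR_cvg0 x0) => /cvg_at_rightP; apply; split => //.
  rewrite -[X in _ --> X](mulr0 u); apply: cvgM; first exact: cvg_cst.
  by have := @cvg_harmonic R; rewrite -cvg_shiftS.
suff -> : (u `^ x)%:E = (\int[mu]_(t in `]0%R, u]) f t)%E by [].
have {}cF : (u `^ x - (u / n.+2%:R) `^ x)%:E @[n --> \oo] -->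
    (\int[mu]_(t in `]0%R, u]) f t)%E.
  by move: cF; rewrite (funext FE).
apply: (cvg_unique _ _ cF) => //; apply: cvg_EFin; first exact: nearW.
rewrite -[X in _ --> X]subr0; apply: cvgB => //; exact: cvg_cst.
Qed.

(** Extended-real version of [Gamma], so that Tonelli's theorem applies before finiteness is known;
    [Gamma] itself would take a conventional value on a divergent integral. *)
Definition gamma_ereal x : \bar R :=
  (\int[mu]_(t in `]0%R, +oo[) (t `^ (x - 1) * expR (- t))%:E)%E.

Lemma measurable_gamma_integrand x :
  measurable_fun setT ((fun t => t `^ (x - 1) * expR (- t)) : RR -> R).
Proof.
apply: measurable_funM; first exact: measurable_powR.
by apply: continuous_measurable_fun; exact: continuous_expRN.
Qed.

Lemma measurable_EFin_gamma_integrand x (D : set RR) :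
  measurable_fun D ((fun t => (t `^ (x - 1) * expR (- t))%:E) : RR -> \bar R).
Proof.
by apply: measurable_funTS; apply/measurable_EFinP; exact: measurable_gamma_integrand.
Qed.

Lemma gamma_ereal_ge0 x : (0 <= gamma_ereal x)%E.
Proof.
by apply: integral_ge0 => t _; rewrite lee_fin mulr_ge0 ?powR_ge0 ?expR_ge0.
Qed.

(* Tonelli on [0 < t <= u], writing u^x as the integral of x t^(x-1) over ]0,u]
   and e^-t as the integral of e^-u over [t,+oo[. *)
Lemma gamma_erealS x : 0 < x -> gamma_ereal (x + 1) = (x%:E * gamma_ereal x)%E.
Proof.
move=> x0.
pose k (v : R * R) : \bar R :=
  (((0 < v.2) && (v.2 <= v.1))%R%:R * (x * v.2 `^ (x - 1) * expR (- v.1)))%:E.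
have mk : measurable_fun setT (k : RR * RR -> \bar R).
  apply/measurable_EFinP; apply: measurable_funM; last first.
    apply: measurable_funM.
      apply: measurable_funM => //.
      exact: (measurableT_comp (measurable_powR (x - 1)) measurable_snd).
    apply: (measurableT_comp (continuous_measurable_fun continuous_expRN)).
    exact: measurable_fst.
  rewrite (_ : (fun v => _) = (fun v => if (0 < v.2) && (v.2 <= v.1) then 1 else 0)).
    apply: measurable_fun_ifT => //; apply: measurable_and.
      exact: (@measurable_fun_ltr _ (RR * RR)%type R setT (cst 0) snd).
    exact: (@measurable_fun_ler _ (RR * RR)%type R setT snd fst).
  by apply/funext => v; case: andP.
have k0 v : (0 <= k v)%E.
  by rewrite lee_fin mulr_ge0// mulr_ge0 ?expR_ge0// mulr_ge0 ?powR_ge0// ltW.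
have mP D : measurable D -> measurable_fun (D : set RR) (fun t : RR => (x * t `^ (x - 1))%:E).
  move=> mD; apply: measurable_funTS; apply/measurable_EFinP.
  by apply: measurable_funM => //; exact: measurable_powR.
have mE D : measurable D -> measurable_fun (D : set RR) (fun t : RR => (expR (- t))%:E).
  move=> mD; apply: measurable_funTS; apply/measurable_EFinP.
  exact: continuous_measurable_fun continuous_expRN.
have := @fubini_tonelli _ _ RR RR R mu mu k mk k0.
rewrite (_ : (\int[mu]_u \int[mu]_t k (u, t))%E = gamma_ereal (x + 1)); last first.
  rewrite /gamma_ereal [RHS]integral_mkcond; apply: eq_integral => u _.
  rewrite /patch mem_setE in_itv/= andbT; case: ifPn => [u0|].
    rewrite addrK mulrC EFinM -integral_powR// -ge0_integralZl//; last 2 first.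
    - by apply: mP; exact: measurable_itv.
    - by move=> t _; rewrite lee_fin mulr_ge0 ?powR_ge0// ltW.
    rewrite [RHS]integral_mkcond; apply: eq_integral => t _.
    rewrite /patch mem_setE in_itv/= /k/=.
    by case: ifPn => _; rewrite ?mul0r// mul1r -EFinM mulrC.
  rewrite -leNgt => u0; apply: integral0_eq => t _; rewrite /k/=.
  case: andP => [[t0 tu]|]; last by rewrite mul0r.
  by have := lt_le_trans t0 (le_trans tu u0); rewrite ltxx.
move=> ->; rewrite /gamma_ereal -ge0_integralZl; [|exact: measurable_itv| | |]; last 3 first.
- exact: measurable_EFin_gamma_integrand.
- by move=> t _; rewrite lee_fin mulr_ge0 ?powR_ge0 ?expR_ge0.
- by rewrite lee_fin ltW.
rewrite [RHS]integral_mkcond; apply: eq_integral => t _.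
rewrite /patch mem_setE in_itv/= andbT; case: ifPn => [t0|].
  rewrite -EFinM mulrA EFinM -integral_expRN -ge0_integralZl//; last 2 first.
  - by apply: mE; exact: measurable_itv.
  - by rewrite lee_fin mulr_ge0 ?powR_ge0// ltW.
  rewrite [RHS]integral_mkcond; apply: eq_integral => u _.
  rewrite /patch mem_setE in_itv/= /k/= andbT t0/=.
  by case: ifPn => _; rewrite ?mul0r// mul1r -EFinM.
by move=> t0; apply: integral0_eq => u _; rewrite /k/= (negbTE t0) mul0r.
Qed.

Lemma gamma_ereal1 : gamma_ereal 1 = 1%E.
Proof.
rewrite /gamma_ereal; under eq_integral do rewrite subrr powRr0 mul1r.
rewrite integral_itv_obnd_cbnd; last first.
  apply: measurable_funTS; apply/measurable_EFinP.
  by apply: continuous_measurable_fun; exact: continuous_expRN.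
by rewrite integral_expRN oppr0 expR0.
Qed.

(** The functional equation settles positive integers; for y >= 1 the bound t^(y-1) <= 1 + t^n with
    n the integer part of y reduces to these; for x > 0 an infinite value at x would make the value
    at x + 1 infinite. *)
Lemma gamma_ereal_fin x : 0 < x -> (gamma_ereal x < +oo)%E.
Proof.
have natfin n : (gamma_ereal n.+1%:R < +oo)%E.
  elim: n => [|n ih]; first by rewrite gamma_ereal1 ltry.
  by rewrite -natr1 gamma_erealS// lte_mul_pinfty// lee_fin.
have ge1fin y : 1 <= y -> (gamma_ereal y < +oo)%E.
  move=> y1; pose n := Num.truncn y.
  have yn : y - 1 <= n%:R.
    by rewrite lerBlDr natr1 ltW// truncnS_gt.
  apply: (@le_lt_trans _ _ (gamma_ereal 1 + gamma_ereal n.+1%:R)%E); last first.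
    by apply: lte_add_pinfty; [rewrite gamma_ereal1 ltry|exact: natfin].
  have mg z := @measurable_EFin_gamma_integrand z `]0%R, +oo[%classic.
  have g0 z t : (0 <= (t `^ (z - 1) * expR (- t))%:E)%E.
    by rewrite lee_fin mulr_ge0 ?powR_ge0 ?expR_ge0.
  rewrite /gamma_ereal -ge0_integralD//.
  apply: ge0_le_integral => //.
  - by apply: emeasurable_funD; exact: mg.
  - move=> t; rewrite /= in_itv/= andbT => t0.
    rewrite -EFinD lee_fin -mulrDl ler_wpM2r ?expR_ge0//.
    rewrite subrr powRr0 -natr1 addrK; have [t1|t1] := leP t 1.
      apply: ler_wpDr; rewrite ?powR_ge0//.
      have := @ger_powR _ t _ 0 (y - 1); rewrite powRr0 subr_ge0 t0 t1.
      by apply.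
    apply: ler_wpDl => //; apply: ler_powR => //; exact: ltW.
move=> x0; have x1 : 1 <= x + 1 by rewrite lerDr ltW.
have := ge1fin _ x1; rewrite gamma_erealS//.
by apply: contraTT; rewrite -!leNgt !leye_eq => /eqP ->; rewrite gt0_muley.
Qed.

Lemma gamma_erealE x : 0 < x -> gamma_ereal x = (Gamma x)%:E.
Proof.
move=> x0; rewrite /Gamma /Rintegral fineK// ge0_fin_numE ?gamma_ereal_ge0//.
exact: gamma_ereal_fin.
Qed.

Lemma GammaS x : 0 < x -> Gamma (x + 1) = x * Gamma x.
Proof.
move=> x0; have x1 : 0 < x + 1 by rewrite addr_gt0.
have := gamma_erealS x0; rewrite (gamma_erealE x0) (gamma_erealE x1).
by move: (Gamma (x + 1)) (Gamma x) => a b [].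
Qed.

Lemma Gamma_gt0 x : 0 < x -> 0 < Gamma x.
Proof.
move=> x0; rewrite -lte_fin -gamma_erealE//.
have mg := @measurable_EFin_gamma_integrand x `]0%R, +oo[%classic.
have g0 t : (0 <= (t `^ (x - 1) * expR (- t))%:E)%E.
  by rewrite lee_fin mulr_ge0 ?powR_ge0 ?expR_ge0.
have sub : (`[1%R, 2%R] : set R) `<=` `]0%R, +oo[.
  by move=> t; rewrite /= !in_itv/= andbT => /andP[t1 _]; rewrite (lt_le_trans ltr01).
(* On [1, 2], t^(x-1) >= t^(-1) >= 1/2 because x > 0, and e^(-t) >= e^(-2). *)
apply: (@lt_le_trans _ _ (\int[mu]_(t in `[1%R, 2%R]) (cst (2^-1 * expR (- 2))%:E) t)%E).
  rewrite integral_cst//= lebesgue_measure_itv/= lte_fin ltr1n -EFinB -EFinM lte_fin.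
  by rewrite !mulr_gt0 ?expR_gt0// subr_gt0 ltr1n.
apply: (@le_trans _ _ (\int[mu]_(t in `[1%R, 2%R]) (t `^ (x - 1) * expR (- t))%:E)%E).
  apply: ge0_le_integral => //.
  - by move=> t _; rewrite lee_fin mulr_ge0 ?expR_ge0.
  - exact: measurable_funS mg.
  - move=> t; rewrite /= in_itv/= => /andP[t1 t2]; rewrite lee_fin.
    apply: ler_pM; rewrite ?expR_ge0 ?ler_expR ?lerN2//.
    apply: (@le_trans _ _ (t `^ (- 1))).
      rewrite powR_inv1 ?(le_trans ler01)// lef_pV2 ?posrE//.
      exact: lt_le_trans t1.
    by apply: ler_powR => //; rewrite lerBrDr addNr ltW.
exact: ge0_subset_integral.
Qed.

(* Cauchy-Schwarz: 2 t^(x-y-1) <= l t^(x-1) + t^(x-2y-1) / l, at the optimal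
   l = Gamma (x - y) / Gamma x. *)
Lemma Gamma_log_convex x y : 0 < y -> 0 < x - 2 * y ->
  Gamma (x - y) ^+ 2 <= Gamma x * Gamma (x - 2 * y).
Proof.
move=> y0 xy; have x0 : 0 < x by lra.
have xy1 : 0 < x - y by lra.
have mg z := @measurable_EFin_gamma_integrand z `]0%R, +oo[%classic.
have g0 z t : (0 <= (t `^ (z - 1) * expR (- t))%:E)%E.
  by rewrite lee_fin mulr_ge0 ?powR_ge0 ?expR_ge0.
have key l A B C : gamma_ereal x = A%:E -> gamma_ereal (x - 2 * y) = B%:E ->
    gamma_ereal (x - y) = C%:E -> 0 < l -> 2 * C <= l * A + l^-1 * B.
  move=> EA EB EC l0; rewrite -lee_fin EFinD !EFinM -EA -EB -EC /gamma_ereal.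
  rewrite -!ge0_integralZl//; try exact: mg.
  2-3: by rewrite lee_fin ltW ?invr_gt0.
  rewrite -ge0_integralD//; last 4 first.
  - by move=> t _; apply: mule_ge0 => //; rewrite lee_fin ltW.
  - by apply: measurable_funeM; exact: mg.
  - by move=> t _; apply: mule_ge0 => //; rewrite lee_fin invr_ge0 ltW.
  - by apply: measurable_funeM; exact: mg.
  apply: ge0_le_integral => //.
  - by move=> t _; apply: mule_ge0.
  - by apply: measurable_funeM; exact: mg.
  - by apply: emeasurable_funD; apply: measurable_funeM; exact: mg.
  move=> t; rewrite /= in_itv/= andbT => t0.
  rewrite -!EFinM -EFinD lee_fin !mulrA -mulrDl ler_wpM2r ?expR_ge0//.
  have tz : t != 0 by rewrite gt_eqF.
  have -> : x - 1 = (x - 2 * y - 1) + y + y by ring.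
  have -> : x - y - 1 = (x - 2 * y - 1) + y by ring.
  move: (x - 2 * y - 1) => z.
  rewrite !(@powRD _ t) ?tz ?implybT//.
  set a := t `^ z; set q := t `^ y.
  have a0 : 0 <= a by exact: powR_ge0.
  rewrite -subr_ge0 (_ : _ - _ = a * (l * q - 1) ^+ 2 / l); last by field; rewrite gt_eqF.
  by apply: divr_ge0; [apply: mulr_ge0 => //; exact: sqr_ge0|exact: ltW].
have Gx := Gamma_gt0 x0; have Gxy := Gamma_gt0 xy1.
move: (gamma_erealE x0) (gamma_erealE xy) (gamma_erealE xy1) Gx Gxy.
move: (Gamma x) (Gamma (x - 2 * y)) (Gamma (x - y)) => A B C EA EB EC A0 C0.
have := key _ _ _ _ EA EB EC (divr_gt0 C0 A0); rewrite mulfVK ?gt_eqF// invf_div.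
rewrite -lerBlDl (_ : _ - _ = C); last by ring.
by rewrite mulrAC ler_pdivlMr// expr2.
Qed.

End gamma.

(** * Lebesgue measure on the complex plane *)

Section affine.
Variable R : realType.
Local Notation mu := (@lebesgue_measure R).
Local Notation RR := (measurableTypeR R).

(** By uniqueness of Lebesgue measure: the rescaled image measure gives half-open intervals their
    length. *)
Lemma lebesgue_measure_affine (c t : R) (A : set RR) : 0 < c -> measurable A ->
  (c%:E * mu ((fun x : R => c * x + t)%R @^-1` A) = mu A)%E.
Proof.
move=> c0 mA.
have mf : measurable_fun setT ((fun x : R => c * x + t) : RR -> RR).
  apply: measurable_funD => //; exact: measurable_funM.
pose m : {measure set RR -> \bar R} := mscale (NngNum (ltW c0))
  (measure_function_pushforward__canonical__measure_function_Measure mu mf).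
have -> : (c%:E * mu ((fun x : R => c * x + t)%R @^-1` A) = m A)%E by [].
apply/esym; apply: lebesgue_measure_unique => // X [[a b] _ <-].
rewrite /= /mscale /= /pushforward.
rewrite (_ : _ @^-1` _ = `](a - t) / c, (b - t) / c]%classic); last first.
  apply/seteqP; split => x /=; rewrite !in_itv/= ltr_pdivrMr// ler_pdivlMr//; lra.
rewrite !lebesgue_measure_itv/= !lte_fin ltr_pM2r ?invr_gt0// ltrD2r.
case: ifPn => _; last by rewrite mule0.
by rewrite -!EFinB -EFinM; congr EFin; field; lra.
Qed.

Lemma ge0_integral_affine (c t : R) (h : R -> \bar R) : 0 < c ->
  measurable_fun setT (h : RR -> \bar R) -> (forall x, 0 <= h x)%E ->
  (\int[mu]_x h x = c%:E * \int[mu]_x h (c * x + t)%R)%E.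
Proof.
move=> c0 mh h0.
have mf : measurable_fun setT ((fun x : R => c * x + t) : RR -> RR).
  apply: measurable_funD => //; exact: measurable_funM.
pose pf := measure_function_pushforward__canonical__measure_function_Measure mu mf.
pose m : {measure set RR -> \bar R} := mscale (NngNum (ltW c0)) pf.
rewrite (@eq_measure_integral _ _ _ setT m) => [|A mA _].
  rewrite ge0_integral_mscale//.
  by rewrite ge0_integral_pushforward.
exact/esym/lebesgue_measure_affine.
Qed.

End affine.

(** * Plane integrals under shears, scalings and rotations *)

Section plane.
Variable R : realType.
Local Notation mu := (@lebesgue_measure R).
Local Notation RR := (measurableTypeR R).
Implicit Type h : R * R -> \bar R.

Lemma ge0_integral_shear2 h (c : R) :
  measurable_fun setT (h : RR * RR -> \bar R) -> (forall x, 0 <= h x)%E ->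
  (\int[mu]_x \int[mu]_y h (x, y + c * x)%R = \int[mu]_x \int[mu]_y h (x, y))%E.
Proof.
move=> mh h0; apply: eq_integral => x _.
rewrite [RHS](@ge0_integral_affine R 1 (c * x))// ?mul1e.
  by apply: eq_integral => y _; rewrite mul1r.
exact: measurableT_comp mh _.
Qed.

Lemma measurable_linear_plane h (a b c e : R) :
  measurable_fun setT (h : RR * RR -> \bar R) ->
  measurable_fun setT
    ((fun u => h (a * u.1 + b * u.2, c * u.1 + e * u.2)) : RR * RR -> \bar R).
Proof.
move=> mh; apply: measurableT_comp mh _.
by apply: measurable_fun_pair; apply: measurable_funD; apply: measurable_funM;
  (exact: measurable_cst || exact: measurable_fst || exact: measurable_snd).
Qed.

Lemma ge0_integral_swap h :
  measurable_fun setT (h : RR * RR -> \bar R) -> (forall x, 0 <= h x)%E ->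
  (\int[mu]_x \int[mu]_y h (x, y) = \int[mu]_y \int[mu]_x h (x, y))%E.
Proof. by move=> mh h0; exact: (@fubini_tonelli _ _ RR RR R mu mu h). Qed.

Lemma ge0_integral_shear1 h (c : R) :
  measurable_fun setT (h : RR * RR -> \bar R) -> (forall x, 0 <= h x)%E ->
  (\int[mu]_x \int[mu]_y h (x + c * y, y)%R = \int[mu]_x \int[mu]_y h (x, y))%E.
Proof.
move=> mh h0.
pose g (u : R * R) := h (u.1 + c * u.2, u.2).
have mg : measurable_fun setT (g : RR * RR -> \bar R).
  have := measurable_linear_plane 1 c 0 1 mh.
  by under [X in measurable_fun _ X]eq_fun do rewrite !mul1r mul0r add0r.
transitivity (\int[mu]_y \int[mu]_x g (x, y))%E.
  by apply: (ge0_integral_swap mg) => x; exact: h0.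
transitivity (\int[mu]_y \int[mu]_x h (x, y))%E; last first.
  exact/esym/ge0_integral_swap.
apply: eq_integral => y _.
rewrite [RHS](@ge0_integral_affine R 1 (c * y))// ?mul1e.
  by apply: eq_integral => x _; rewrite mul1r.
exact: measurableT_comp mh _.
Qed.

Lemma ge0_integral_scale2 h (c : R) : 0 < c ->
  measurable_fun setT (h : RR * RR -> \bar R) -> (forall x, 0 <= h x)%E ->
  (\int[mu]_x \int[mu]_y h (x, y) =
   (c ^+ 2)%:E * \int[mu]_x \int[mu]_y h (c * x, c * y)%R)%E.
Proof.
move=> c0 mh h0.
transitivity (c%:E * \int[mu]_x \int[mu]_y h (c * x + 0, y)%R)%E.
  apply: (@ge0_integral_affine R c 0 (fun x => \int[mu]_y h (x, y))%E c0).
    exact: (@measurable_fun_fubini_tonelli_F _ _ RR RR R mu h).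
  by move=> x; exact: integral_ge0.
rewrite expr2 EFinM -muleA; congr (_ * _)%E.
have mF : measurable_fun setT ((fun x => \int[mu]_y h (c * x, c * y)%R)%E : RR -> \bar R).
  rewrite (_ : (fun x => _) =
      fubini_F mu (fun u : RR * RR => h (c * u.1 + 0 * u.2, 0 * u.1 + c * u.2))).
    apply: measurable_fun_fubini_tonelli_F => //.
    exact: measurable_linear_plane.
  by apply/funext => x; apply: eq_integral => y _; rewrite /= !mul0r addr0 add0r.
rewrite -(ge0_integralZl mu measurableT mF)//; last 2 first.
- by move=> x _; exact: integral_ge0.
- by rewrite lee_fin ltW.
apply: eq_integral => x _; rewrite addr0.
transitivity (c%:E * \int[mu]_y h (c * x, c * y + 0)%R)%E.
  apply: (@ge0_integral_affine R c 0 (fun y => h (c * x, y))) => //.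
  exact: measurableT_comp mh _.
by congr (_ * _)%E; apply: eq_integral => y _; rewrite addr0.
Qed.

(* A rotation by an angle other than 0 and pi is a product of three shears; the
   rotation by pi is a square. *)
Lemma ge0_integral_rotation h (a b : R) : a ^+ 2 + b ^+ 2 = 1 ->
  measurable_fun setT (h : RR * RR -> \bar R) -> (forall x, 0 <= h x)%E ->
  (\int[mu]_x \int[mu]_y h (a * x - b * y, b * x + a * y)%R =
   \int[mu]_x \int[mu]_y h (x, y))%E.
Proof.
have rot_b g (a' b' : R) : a' ^+ 2 + b' ^+ 2 = 1 -> b' != 0 ->
    measurable_fun setT (g : RR * RR -> \bar R) -> (forall x, 0 <= g x)%E ->
    (\int[mu]_x \int[mu]_y g (a' * x - b' * y, b' * x + a' * y)%R =
     \int[mu]_x \int[mu]_y g (x, y))%E.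
  (* Minus the tangent of half the angle. As 1 + b' k = a' and k (1 + a') = - b', the shears with
     parameters k, b', k compose to the rotation. *)
  move=> ab b0 mg g0; pose k := (a' - 1) / b'.
  pose g1 u := g (u.1 + k * u.2, u.2).
  pose g2 u := g1 (u.1, u.2 + b' * u.1).
  have mg1 : measurable_fun setT (g1 : RR * RR -> \bar R).
    have := measurable_linear_plane 1 k 0 1 mg.
    by under [X in measurable_fun _ X]eq_fun do rewrite !mul1r mul0r add0r.
  have mg2 : measurable_fun setT (g2 : RR * RR -> \bar R).
    have := measurable_linear_plane 1 0 b' 1 mg1.
    under [X in measurable_fun _ X]eq_fun do
      rewrite !mul1r mul0r addr0 [(b' * _ + _)%R]addrC.
    by [].
  rewrite -(ge0_integral_shear1 k mg g0).
  rewrite -(ge0_integral_shear2 b' mg1) => [|x]; last exact: g0.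
  rewrite -(ge0_integral_shear1 k mg2) => [|x]; last exact: g0.
  apply: eq_integral => x _; apply: eq_integral => y _.
  rewrite /g2 /g1 /=; congr (g (_, _)); rewrite /k.
    have e : - b' * y = (a' ^+ 2 - 1) / b' * y.
      by rewrite (_ : a' ^+ 2 - 1 = - b' ^+ 2); [field|lra].
    by rewrite -[- (b' * y)]mulNr e; field.
  by field.
move=> ab mh h0; have [b0|b0] := eqVneq b 0; last exact: rot_b.
have : a ^+ 2 = 1 by rewrite -ab b0; ring.
move=> /eqP; rewrite sqrf_eq1 b0 => /orP[|] /eqP ->.
  apply: eq_integral => x _; apply: eq_integral => y _.
  by congr (h (_, _)); ring.
have e01 : (0 : R) ^+ 2 + 1 ^+ 2 = 1 by ring.
have mh1 := measurable_linear_plane 0 (-1) 1 0 mh.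
have := rot_b _ 0 1 e01 (oner_neq0 _) mh1 (fun=> h0 _).
have := rot_b h 0 1 e01 (oner_neq0 _) mh h0.
move=> <- /=; rewrite (_ : (\int[mu]_x \int[mu]_y h (0 * x + -1 * y, 1 * x + 0 * y)%R =
  \int[mu]_x \int[mu]_y h (0 * x - 1 * y, 1 * x + 0 * y)%R)%E); last first.
  by apply: eq_integral => x _; apply: eq_integral => y _; congr (h (_, _)); ring.
by move=> <-; apply: eq_integral => x _; apply: eq_integral => y _;
  congr (h (_, _)); ring.
Qed.

End plane.

(** * Measurability of complex-valued functions *)

Section complex_measurability.
Context d (T : measurableType d) (R : realType).
Implicit Types f g : T -> R[i].

Lemma measurable_Re : measurable_fun setT (@complex.Re R).
Proof. exact: measurableT_comp measurable_fst (@measurable_pair_of_complex R). Qed.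

Lemma measurable_Im : measurable_fun setT (@complex.Im R).
Proof. exact: measurableT_comp measurable_snd (@measurable_pair_of_complex R). Qed.

Lemma measurable_fun_complex f : measurable_fun setT (@complex.Re R \o f) ->
  measurable_fun setT (@complex.Im R \o f) -> measurable_fun setT f.
Proof.
move=> mr mi.
have mp : measurable_fun setT (fun x => (complex.Re (f x), complex.Im (f x))).
  exact: measurable_fun_pair.
rewrite (_ : f = @complex_of_pair R \o (fun x => (complex.Re (f x), complex.Im (f x)))).
  apply: measurableT_comp mp; exact: measurable_complex_of_pair.
by apply/funext => x /=; case: (f x).
Qed.

Lemma measurable_cadd f g : measurable_fun setT f -> measurable_fun setT g ->
  measurable_fun setT (fun x => f x + g x).
Proof.
move=> mf mg; apply: measurable_fun_complex.
- rewrite (_ : _ \o _ = (fun x => complex.Re (f x) + complex.Re (g x))).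
    by apply: measurable_funD; apply: (measurableT_comp measurable_Re).
  by apply/funext => x /=; case: (f x); case: (g x).
- rewrite (_ : _ \o _ = (fun x => complex.Im (f x) + complex.Im (g x))).
    by apply: measurable_funD; apply: (measurableT_comp measurable_Im).
  by apply/funext => x /=; case: (f x); case: (g x).
Qed.

Lemma measurable_cmul f g : measurable_fun setT f -> measurable_fun setT g ->
  measurable_fun setT (fun x => f x * g x).
Proof.
move=> mf mg.
have mRf := measurableT_comp measurable_Re mf.
have mRg := measurableT_comp measurable_Re mg.
have mIf := measurableT_comp measurable_Im mf.
have mIg := measurableT_comp measurable_Im mg.
apply: measurable_fun_complex.
- rewrite (_ : _ \o _ = (fun x => complex.Re (f x) * complex.Re (g x) -
    complex.Im (f x) * complex.Im (g x))).
    by apply: measurable_funB; apply: measurable_funM.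
  by apply/funext => x /=; case: (f x); case: (g x).
- rewrite (_ : _ \o _ = (fun x => complex.Re (f x) * complex.Im (g x) +
    complex.Im (f x) * complex.Re (g x))).
    by apply: measurable_funD; apply: measurable_funM.
  by apply/funext => x /=; case: (f x); case: (g x).
Qed.

Lemma measurable_cconj f : measurable_fun setT f ->
  measurable_fun setT (fun x => (f x)^*).
Proof.
move=> mf; apply: measurable_fun_complex.
- rewrite (_ : _ \o _ = (fun x => complex.Re (f x))).
    exact: measurableT_comp measurable_Re mf.
  by apply/funext => x /=; case: (f x).
- rewrite (_ : _ \o _ = (fun x => - complex.Im (f x))).
    by apply: measurableT_comp => //; exact: measurableT_comp measurable_Im mf.
  by apply/funext => x /=; case: (f x).
Qed.

Lemma measurable_csum n (F : 'I_n -> T -> R[i]) :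
  (forall i, measurable_fun setT (F i)) ->
  measurable_fun setT (fun x => \sum_(i < n) F i x).
Proof.
elim: n F => [|n ih] F mF.
  by under eq_fun do rewrite big_ord0; exact: measurable_cst.
under eq_fun do rewrite big_ord_recl.
by apply: measurable_cadd => //; apply: ih.
Qed.

Lemma measurable_cexp f n : measurable_fun setT f ->
  measurable_fun setT (fun x => f x ^+ n).
Proof.
move=> mf; elim: n => [|n ih].
  by under eq_fun do rewrite expr0; exact: measurable_cst.
by under eq_fun do rewrite exprS; exact: measurable_cmul.
Qed.

Lemma measurable_horner f (P : {poly R[i]}) : measurable_fun setT f ->
  measurable_fun setT (fun x => P.[f x]).
Proof.
move=> mf; under eq_fun do rewrite horner_coef.
apply: measurable_csum => i; apply: measurable_cmul.
  exact: measurable_cst.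
exact: measurable_cexp.
Qed.

Lemma measurable_normc f : measurable_fun setT f ->
  measurable_fun setT (fun x => normc (f x)).
Proof.
move=> mf; rewrite (_ : (fun x => _) =
  (fun x => Num.sqrt (complex.Re (f x) ^+ 2 + complex.Im (f x) ^+ 2))).
  have ms : measurable_fun setT (@Num.sqrt R).
    by apply: continuous_measurable_fun; exact: sqrt_continuous.
  apply: (measurableT_comp ms).
  by apply: measurable_funD; apply: measurable_funX;
    [exact: measurableT_comp measurable_Re mf|exact: measurableT_comp measurable_Im mf].
by apply/funext => x; case: (f x).
Qed.

End complex_measurability.

Lemma ge0_integral_mrestr d (T : measurableType d) (R : realType)
    (m : {measure set T -> \bar R}) (D : set T) (mD : measurable D) (h : T -> \bar R) :
  measurable_fun setT h -> (forall x, 0 <= h x)%E ->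
  (\int[mrestr m mD]_x h x = \int[m]_(x in D) h x)%E.
Proof.
move=> mh h0.
have N0 : mrestr m mD (~` D) = 0%E by rewrite /mrestr setICl measure0.
rewrite (ge0_negligible_integral (measurableC mD) measurableT mh _ N0)//.
rewrite setTD setCK; apply: eq_measure_integral => A mA AD.
by transitivity (m (A `&` D)) => //; rewrite setIidl.
Qed.

(** * Rotation invariance and radial integrals in the complex plane *)

Section complex_lebesgue.
Variable R : realType.
Local Notation mu := (@lebesgue_measure R).
Local Notation RR := (measurableTypeR R).
Local Notation muC := (lebesgue_complex R).
Implicit Type h : R[i] -> \bar R.

Lemma measurable_complex_of_pair_comp h : measurable_fun setT h ->
  measurable_fun setT (h \o @complex_of_pair R : RR * RR -> \bar R).
Proof. by move=> mh; apply: measurableT_comp mh _; exact: measurable_complex_of_pair. Qed.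

Lemma ge0_integral_complex h : measurable_fun setT h -> (forall w, 0 <= h w)%E ->
  (\int[muC]_w h w = \int[mu]_x \int[mu]_y h (x +i* y))%E.
Proof.
move=> mh h0.
have mf := @measurable_complex_of_pair R.
pose m := measure_function_pushforward__canonical__measure_function_Measure
  (mu \x mu)%E mf.
transitivity (\int[m]_w h w)%E; first by apply: eq_measure_integral.
rewrite ge0_integral_pushforward// preimage_setT.
apply: (@fubini_tonelli1 _ _ RR RR R mu mu (h \o @complex_of_pair R)).
  exact: measurable_complex_of_pair_comp.
by move=> x; exact: h0.
Qed.

Lemma ge0_integral_cmul h (o : R[i]) : normc o = 1 -> measurable_fun setT h ->
  (forall w, 0 <= h w)%E -> (\int[muC]_w h (o * w)%R = \int[muC]_w h w)%E.
Proof.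
case: o => a b /= o1 mh h0.
have ab : a ^+ 2 + b ^+ 2 = 1.
  by rewrite -[LHS]sqr_sqrtr ?o1 ?expr1n// addr_ge0// sqr_ge0.
have mho : measurable_fun setT (fun w => h (a +i* b * w)%R).
  apply: measurableT_comp mh _.
  by apply: measurable_cmul; [exact: measurable_cst|exact: measurable_id].
etransitivity; first by apply: (ge0_integral_complex mho) => w; exact: h0.
etransitivity; last exact/esym/ge0_integral_complex.
etransitivity; last first.
  apply: (ge0_integral_rotation ab (measurable_complex_of_pair_comp mh)).
  by move=> x; exact: h0.
apply: eq_integral => x _; apply: eq_integral => y _.
by congr (h (_ +i* _)); rewrite addrC.
Qed.

(** Indexed by the squared radius, which makes the area linear in the index. *)
Definition disc (t : R) : set R[i] := [set w | normc w ^+ 2 < t].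

Lemma measurable_disc t : measurable (disc t).
Proof.
have m : measurable_fun setT (fun w : R[i] => normc w ^+ 2).
  by apply: measurable_funX; apply: measurable_normc.
rewrite (_ : disc t = setT `&` (fun w : R[i] => normc w ^+ 2) @^-1` `]-oo, t[%classic).
  exact: m.
by rewrite setTI; apply/seteqP; split=> w /=; rewrite in_itv.
Qed.

Lemma sqr_normcE (x y : R) : normc (x +i* y) ^+ 2 = x ^+ 2 + y ^+ 2.
Proof. by rewrite /= sqr_sqrtr// addr_ge0// sqr_ge0. Qed.

Lemma area_disc t : 0 < t -> (muC (disc t) = t%:E * muC (disc 1))%E.
Proof.
move=> t0.
have mi s : measurable_fun setT (fun w : R[i] => (\1_(disc s) w)%:E : \bar R).
  by apply/measurable_EFinP; apply: measurable_indic; exact: measurable_disc.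
have area s : (muC (disc s) = \int[mu]_x \int[mu]_y (\1_(disc s) (x +i* y))%:E)%E.
  rewrite -(ge0_integral_complex (mi s)) => [|w]; last by rewrite lee_fin.
  by rewrite integral_indic ?setIT//; exact: measurable_disc.
rewrite !area.
have t1 : 0 < Num.sqrt t by rewrite sqrtr_gt0.
have tt : Num.sqrt t ^+ 2 = t by rewrite sqr_sqrtr// ltW.
rewrite (ge0_integral_scale2 t1 (measurable_complex_of_pair_comp (mi t))); last first.
  by move=> x; rewrite lee_fin.
rewrite tt; apply: (congr1 (mule t%:E)).
apply: eq_integral => x _; apply: eq_integral => y _; congr EFin.
rewrite /= !indicE; congr (_ : bool)%:R.
apply/idP/idP; rewrite !inE /disc /mkset !sqr_normcE !exprMn -!mulrDr sqr_sqrtr ?ltW//.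
  by rewrite -[X in _ < X]mulr1 ltr_pM2l.
by rewrite -[X in _ -> _ < X]mulr1 ltr_pM2l.
Qed.

Lemma lebesgue_complex_itv (a b : R) : a < b ->
  muC ((@pair_of_complex R) @^-1` (`[a, b] `*` `[a, b])) = ((b - a) ^+ 2)%:E.
Proof.
move=> ab; transitivity ((mu \x mu)%E (`[a, b]%classic `*` `[a, b]%classic : set (RR * RR))).
  by [].
rewrite product_measure1E//= lebesgue_measure_itv/= lte_fin ab.
by rewrite -EFinB -EFinM expr2.
Qed.

Lemma measurable_itv_complex (a b : R) :
  measurable ((@pair_of_complex R) @^-1` (`[a, b] `*` `[a, b])).
Proof.
rewrite -[X in measurable X]setTI; apply: measurable_pair_of_complex => //.
exact: measurableX.
Qed.

Lemma area_unit_disc_fin : (muC (disc 1) < +oo)%E.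
Proof.
apply: (@le_lt_trans _ _ ((1 - (-1)) ^+ 2)%:E); last exact: ltry.
rewrite -lebesgue_complex_itv; last lra.
apply: le_measure; rewrite ?inE.
- exact: measurable_disc.
- exact: measurable_itv_complex.
- move=> [x y]; rewrite /disc /mkset sqr_normcE => xy.
  by split; rewrite /= in_itv /=; apply/andP; split; nra.
Qed.

Lemma area_unit_disc_gt0 : (0 < muC (disc 1))%E.
Proof.
apply: (@lt_le_trans _ _ ((2^-1 - 0) ^+ 2)%:E); first by rewrite lte_fin; lra.
rewrite -lebesgue_complex_itv; last lra.
apply: le_measure; rewrite ?inE.
- exact: measurable_itv_complex.
- exact: measurable_disc.
- move=> [x y] [] /=; rewrite !in_itv/= => /andP[x0 x1] /andP[y0 y1].
  by rewrite /disc /mkset sqr_normcE; nra.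
Qed.

(** Its numerical value does not matter, as it cancels against the normalization of [dv]; it only
    has to be finite and positive. *)
Definition kappa : R := fine (muC (disc 1)).

Lemma kappaE : kappa%:E = muC (disc 1).
Proof. by rewrite fineK// ge0_fin_numE// area_unit_disc_fin. Qed.

Lemma kappa_gt0 : 0 < kappa.
Proof. by rewrite -lte_fin kappaE area_unit_disc_gt0. Qed.

(** The substitute for polar coordinates. The image of plane measure under the squared modulus is
    [kappa] times Lebesgue measure on [0, +oo[: by [area_disc] the two agree on the rays ]-oo, t[,
    which are stable under intersection and generate the Borel sets. *)
Lemma ge0_integral_radial (h : R -> \bar R) :
  measurable_fun setT h -> (forall t, 0 <= h t)%E ->
  (\int[muC]_w h (normc w ^+ 2)%R =
   kappa%:E * \int[mu]_(t in `[0%R, +oo[) h t)%E.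
Proof.
move=> mh h0.
have mn : measurable_fun setT ((fun w : R[i] => normc w ^+ 2) : R[i] -> RR).
  exact: (measurable_funX 2 (measurable_normc (@measurable_id _ R[i] setT))).
pose nu := measure_function_pushforward__canonical__measure_function_Measure muC mn.
have mI : measurable (`[0%R, +oo[%classic : set RR) by exact: measurable_itv.
pose m : {measure set RR -> \bar R} := mscale (NngNum (ltW kappa_gt0)) (mrestr mu mI).
have nuE A : measurable A -> nu A = m A.
  apply: (@measure_unique _ R RR (@RGenInftyO.G R) (fun n => `]-oo, n%:R[%classic)).
  - exact: RGenInftyO.measurableE.
  - move=> _ _ [x ->] [y ->]; exists (Num.min x y).
    by apply/seteqP; split => z /=; rewrite !in_itv/= lt_min => /andP.
  - by move=> n; exists n%:R.
  - apply/seteqP; split => // x _; exists (Num.truncn `|x|).+1 => //=.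
    by rewrite in_itv/= (le_lt_trans (ler_norm x))// truncnS_gt.
  - move=> _ [t ->]; rewrite /nu/= /pushforward.
    rewrite (_ : _ @^-1` _ = disc t); last first.
      by apply/seteqP; split=> w /=; rewrite in_itv.
    rewrite /mscale/= /mrestr; have [t0|t0] := ltP 0 t.
      rewrite area_disc// -kappaE muleC; apply: (congr1 (mule kappa%:E)).
      rewrite (_ : _ `&` _ = `[0, t[%classic).
        by rewrite lebesgue_measure_itv/= lte_fin t0 sube0.
      apply/seteqP; split => x /=; rewrite !in_itv/= ?andbT.
        by case=> -> ->.
      by move=> /andP[-> ->].
    rewrite (_ : disc t = set0) ?measure0; last first.
      apply/seteqP; split => // w; rewrite /disc /mkset => /lt_le_trans/(_ t0).
      by rewrite ltNge sqr_ge0.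
    rewrite (_ : _ `&` _ = set0) ?measure0 ?mule0//.
    apply/seteqP; split => // x /=; rewrite !in_itv/= andbT => -[xt x0].
    by move: (lt_le_trans xt t0); rewrite ltNge x0.
  - move=> n; rewrite /nu/= /pushforward.
    rewrite (_ : _ @^-1` _ = disc n%:R); last first.
      by apply/seteqP; split=> w /=; rewrite in_itv.
    case: n => [|n].
      rewrite (_ : disc _ = set0) ?measure0 ?ltry//.
      by apply/seteqP; split => // w; rewrite /disc /mkset ltNge sqr_ge0.
    by rewrite area_disc// lte_mul_pinfty ?lee_fin// area_unit_disc_fin.
have mhR : measurable_fun setT (h : RR -> \bar R) by [].
transitivity (\int[nu]_t h t)%E.
  apply/esym; apply: (ge0_integral_pushforward mn muC measurableT mhR) => t _.
  exact: h0.
rewrite (@eq_measure_integral _ _ _ setT m) => [|A mA _]; last exact: nuE.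
by rewrite ge0_integral_mscale// ge0_integral_mrestr.
Qed.

End complex_lebesgue.

(** * Moments over the ball *)

Section parseval.
Variable R : realType.

(** X^n - 1 splits over the algebraically closed field R[i] and is separable; n distinct n-th roots
    of unity include a primitive one. *)
Lemma primitive_root_exists (n : nat) : (0 < n)%N ->
  exists o : R[i], n.-primitive_root o.
Proof.
pose p : {poly R[i]} := 'X^n - 1; have [r Dp] := closed_field_poly_normal p.
move=> n_gt0; rewrite (monicP _) ?monicXnsubC // scale1r in Dp.
have rn1 : all n.-unity_root r by apply/allP=> z; rewrite -root_prod_XsubC -Dp.
have sz_r : (n < (size r).+1)%N.
  by rewrite -(size_prod_XsubC r id) -Dp size_XnsubC.
have [|z] := hasP (has_prim_root n_gt0 rn1 _ sz_r); last by exists z.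
by rewrite -separable_prod_XsubC -Dp separable_Xn_sub_1 // pnatr_eq0 -lt0n.
Qed.

Lemma sqr_normcJ (x : R[i]) : (normc x ^+ 2)%:C = x * x^*.
Proof.
rewrite -[x^*]/(conjc x); case: x => a b; rewrite sqr_normcE; simpc.
by congr (_ +i* _); ring.
Qed.

Lemma normc_real (r : R) : normc r%:C = `|r|.
Proof. by rewrite /= expr0n addr0 sqrtr_sqr. Qed.

Lemma normc_ge0 (x : R[i]) : 0 <= normc x.
Proof. by case: x => a b; exact: sqrtr_ge0. Qed.

Lemma normcX (x : R[i]) n : normc (x ^+ n) = normc x ^+ n.
Proof.
elim: n => [|n ih]; first by rewrite !expr0 Normc.normc1.
by rewrite !exprS Normc.normcM ih.
Qed.

Lemma normc_conj (x : R[i]) : normc x^* = normc x.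
Proof. by rewrite -[x^*]/(conjc x); case: x => a b /=; rewrite sqrrN. Qed.

Lemma primitive_root_normc n (o : R[i]) : n.-primitive_root o -> normc o = 1.
Proof.
move=> po; apply/eqP; rewrite -(@pexpr_eq1 _ _ n) ?normc_ge0 ?(prim_order_gt0 po)//.
by rewrite -normcX (prim_expr_order po) Normc.normc1.
Qed.

(** A geometric sum whose ratio o^(k-l) is an n-th root of unity; since k, l < n, the ratio is 1
    only for k = l. *)
Lemma sum_primitive_root n (o : R[i]) (k l : 'I_n) : n.-primitive_root o ->
  \sum_(j < n) (o ^+ k * (o ^+ l)^*) ^+ j = (n * (k == l))%:R.
Proof.
move=> po.
have o0 : o != 0.
  by apply/eqP => o0; have := primitive_root_normc po;
    rewrite o0 Normc.normc0 => /eqP; rewrite eq_sym oner_eq0.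
have ol : (o ^+ l)^* = o ^- l.
  apply: (@mulfI _ (o ^+ l)); rewrite ?expf_neq0//.
  rewrite divff ?expf_neq0// -sqr_normcJ normcX.
  by rewrite (primitive_root_normc po) !expr1n.
have [->|kl] := eqVneq k l.
  rewrite muln1 ol (eq_bigr (fun=> 1)) => [|j _].
    by rewrite sumr_const card_ord.
  by rewrite divff ?expr1n// expf_neq0.
rewrite muln0; set q := _ * _.
have q1 : q != 1.
  rewrite /q ol; apply/eqP => e.
  have /eqP : o ^+ k = o ^+ l.
    by apply: (mulIf (x := o ^- l)); rewrite ?invr_eq0 ?expf_neq0// e divff// expf_neq0.
  by rewrite (eq_prim_root_expr po) !modn_small// => /eqP /val_inj /eqP; rewrite (negbTE kl).
have qn : q ^+ n = 1.
  rewrite /q exprMn -rmorphXn -!exprM ![(_ * n)%N]mulnC !exprM.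
  by rewrite (prim_expr_order po) !expr1n rmorph1 mulr1.
apply: (@mulfI _ (q - 1)); first by rewrite subr_eq0.
by rewrite -subrX1 qn subrr mulr0.
Qed.

(** A finite average over roots of unity stands in for the integral over a circle. The bound on the
    size of P excludes aliasing: distinct exponents stay distinct modulo n. *)
Lemma parseval (P : {poly R[i]}) n (o y : R[i]) : n.-primitive_root o ->
  (size P <= n)%N ->
  \sum_(j < n) normc P.[o ^+ j * y] ^+ 2 =
  n%:R * \sum_(k < n) normc (P`_k) ^+ 2 * normc y ^+ 2 ^+ k.
Proof.
move=> po Pn; apply: (@complexI R).
rewrite rmorphM /= !rmorph_sum /=.
under eq_bigr => j _.
  rewrite sqr_normcJ (horner_coef_wide _ Pn) rmorph_sum/= big_distrlr/=.
  over.
rewrite exchange_big/= mulr_sumr; apply: eq_bigr => k _.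
rewrite exchange_big/=.
rewrite (bigD1 k)//= [X in _ + X]big1 ?addr0 => [|l lk].
  rewrite (eq_bigr (fun j : 'I_n => (P`_k * (P`_k)^* * (y * y^*) ^+ k) *
      (o ^+ k * (o ^+ k)^*) ^+ j)) => [|j _]; last first.
    rewrite !(rmorphM, rmorphXn)/= !exprMn -!exprM (mulnC k j).
    by ring.
  rewrite -mulr_sumr (sum_primitive_root _ _ po) eqxx muln1.
  rewrite -!sqr_normcJ mulrC [(n%:R)%:C]rmorph_nat; congr (_ * _).
  by rewrite -rmorphXn -rmorphM.
rewrite (eq_bigr (fun j : 'I_n => (P`_k * (P`_l)^* * y ^+ k * (y^*) ^+ l) *
    (o ^+ k * (o ^+ l)^*) ^+ j)) => [|j _]; last first.
  rewrite !(rmorphM, rmorphXn)/= !exprMn -!exprM (mulnC k j) (mulnC l j).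
  by ring.
by rewrite -mulr_sumr (sum_primitive_root _ _ po) eq_sym (negbTE lk) muln0 mulr0.
Qed.

End parseval.

Section moments.
Variable R : realType.
Local Notation mu := (@lebesgue_measure R).
Local Notation RR := (measurableTypeR R).
Local Notation muC := (lebesgue_complex R).

(* Rotation invariance allows averaging over the [n]-th roots of unity, which
   removes the cross terms. *)
Lemma ge0_integral_radial_horner (h : R -> R) (P : {poly R[i]}) n (y : R[i]) :
  measurable_fun setT h -> (forall t, 0 <= h t) -> (size P <= n)%N ->
  (\int[muC]_w (h (normc w ^+ 2) * normc P.[y * w^*] ^+ 2)%:E =
   \sum_(k < n) (normc (P`_k) ^+ 2 * (normc y ^+ 2) ^+ k)%:E *
     \int[muC]_w (h (normc w ^+ 2) * (normc w ^+ 2) ^+ k)%:E)%E.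
Proof.
move=> mh h0 Pn; have [n0|n_gt0] := posnP n.
  have P0 : P = 0 by apply/eqP; rewrite -size_poly_eq0 -leqn0 -n0.
  rewrite P0 n0 big_ord0 integral0_eq// => w _.
  by rewrite horner0 Normc.normc0 expr0n/= mulr0.
have [om po] := primitive_root_exists R n_gt0.
have mn : measurable_fun setT (fun w : R[i] => normc w ^+ 2).
  by apply: measurable_funX; exact: measurable_normc.
have mhn : measurable_fun setT (fun w : R[i] => h (normc w ^+ 2)).
  exact: measurableT_comp mh mn.
pose F (w : R[i]) : \bar R := (h (normc w ^+ 2) * normc P.[y * w^*] ^+ 2)%:E.
have mF : measurable_fun setT F.
  apply/measurable_EFinP; apply: measurable_funM => //.
  apply: measurable_funX; apply: measurable_normc; apply: measurable_horner.
  by apply: measurable_cmul => //; exact: measurable_cconj.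
have F0 w : (0 <= F w)%E by rewrite lee_fin mulr_ge0// sqr_ge0.
(* Conjugated because P is evaluated at y w^*: multiplying w by u j multiplies y w^* by om^j. *)
pose u (j : 'I_n) := (om ^+ j)^*.
have u1 j : normc (u j) = 1.
  by rewrite normc_conj normcX (primitive_root_normc po) expr1n.
have mFu j : measurable_fun setT (fun w => F (u j * w)%R).
  by apply: measurableT_comp mF _; apply: measurable_cmul.
have n1 : \sum_(j < n) (n%:R^-1) = 1 :> R.
  by rewrite sumr_const card_ord -[LHS]mulr_natl divff// pnatr_eq0 -lt0n.
transitivity (\sum_(j < n) (n%:R^-1)%:E * \int[muC]_w F (u j * w)%R)%E.
  under eq_bigr do rewrite (ge0_integral_cmul (u1 _) mF F0).
  by rewrite -ge0_sume_distrl ?sumEFin ?n1 ?mul1e// => j _; rewrite lee_fin.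
transitivity (\int[muC]_w \sum_(j < n) (n%:R^-1)%:E * F (u j * w)%R)%E.
  rewrite ge0_integral_sum//; last 2 first.
  - by move=> j; apply: measurable_funeM.
  - by move=> j w _; apply: mule_ge0.
  by apply: eq_bigr => j _; rewrite ge0_integralZl.
pose c (k : 'I_n) : R := normc (P`_k) ^+ 2 * (normc y ^+ 2) ^+ k.
pose G (k : 'I_n) (w : R[i]) : R := h (normc w ^+ 2) * (normc w ^+ 2) ^+ k.
have mG k : measurable_fun setT (EFin \o G k).
  by apply/measurable_EFinP; apply: measurable_funM => //; apply: measurable_funX.
have G0 k w : (0 <= (G k w)%:E)%E.
  by rewrite lee_fin mulr_ge0// exprn_ge0// sqr_ge0.
have c0 k : (0 <= (c k)%:E)%E by rewrite lee_fin mulr_ge0 ?sqr_ge0// exprn_ge0// sqr_ge0.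
transitivity (\int[muC]_w \sum_(k < n) (c k)%:E * (G k w)%:E)%E; last first.
  rewrite ge0_integral_sum//; last 2 first.
  - by move=> j; apply: measurable_funeM; exact: mG.
  - by move=> j w _; apply: mule_ge0.
  apply: eq_bigr => j _.
  by apply: (ge0_integralZl muC measurableT (mG j)) => [w _|];
    [exact: G0|exact: c0].

apply: eq_integral => w _.
under eq_bigr do rewrite -EFinM; rewrite sumEFin.
under [RHS]eq_bigr do rewrite -EFinM; rewrite sumEFin; congr EFin.
transitivity (n%:R^-1 * h (normc w ^+ 2) *
    \sum_(j < n) normc P.[om ^+ j * (y * w^*)] ^+ 2).
  rewrite mulr_sumr; apply: eq_bigr => j _.
  rewrite Normc.normcM u1 mul1r -mulrA; congr (_ * (_ * normc P.[_] ^+ 2)).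
  by rewrite rmorphM/= /u -[(_^*)^*]/(conjc (conjc _)) conjcK mulrCA.
rewrite (parseval _ po Pn) mulrACA mulVf ?mul1r ?pnatr_eq0 -?lt0n//.
rewrite mulr_sumr; apply: eq_bigr => k _.
by rewrite /c /G Normc.normcM normc_conj !exprMn; ring.
Qed.

(** The substitution t = r x turns the left-hand side into r^(i+m+1) times the beta integral B(i+1,
    m+1). *)
Lemma ge0_integral_beta (i m : nat) (r : R) : 0 < r ->
  (\int[mu]_(t in `[0%R, +oo[) ((t < r)%R%:R * (t ^+ i * (r - t) ^+ m))%:E =
   ((i`! * m`!)%:R / (i + m).+1`!%:R * r ^+ (i + m).+1)%:E)%E.
Proof.
move=> r0.
pose f (t : R) : \bar R := (t ^+ i * (r - t) ^+ m)%:E.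
have mf : measurable_fun setT (f : RR -> \bar R).
  apply/measurable_EFinP; apply: measurable_funM; apply: measurable_funX => //.
  exact: measurable_funB.
transitivity (\int[mu]_(t in `[0%R, r[) f t)%E.
  rewrite [LHS]integral_mkcond [RHS]integral_mkcond; apply: eq_integral => t _.
  rewrite /patch !mem_setE !in_itv/= andbT.
  by case: (0 <= t)%R => //=; case: (t < r)%R; rewrite ?mul1r ?mul0r.
rewrite integral_itv_bndo_bndc; last exact: measurable_funTS.
rewrite integral_mkcond.
rewrite (@ge0_integral_affine R r 0)//; last 2 first.
- by apply/(measurable_restrictT f); [exact: measurable_itv|exact: measurable_funTS].
- move=> t; apply: erestrict_ge0 => {}t /=; rewrite in_itv/= => /andP[t0 t1].
  by rewrite lee_fin mulr_ge0 ?exprn_ge0 ?subr_ge0.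
have -> : (\int[mu]_x (f \_ `[0%R, r]) (r * x + 0)%R =
    \int[mu]_x ((r ^+ (i + m))%:E * ((XMonemX i m : R -> R) \_ `[0%R, 1%R] x)%:E))%E.
  apply: eq_integral => x _; rewrite addr0 /patch !mem_setE !in_itv/=.
  have rx1 : (r * x <= r) = (x <= 1) by rewrite -[X in _ <= X]mulr1 ler_pM2l.
  rewrite pmulr_rge0// rx1.
  case: ifPn => _; last by rewrite mule0.
  rewrite -EFinM; congr EFin; rewrite /f /XMonemX /unstable.onem.
  by rewrite -{2}[r]mulr1 -mulrBr !exprMn exprD; ring.
have mX : measurable_fun setT (fun x => ((XMonemX i m : R -> R) \_ `[0%R, 1%R] x)%:E : \bar R).
  apply/measurable_EFinP; apply/(measurable_restrictT (XMonemX i m : R -> R)) => //.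
  apply: measurable_funTS; apply: measurable_funM; apply: measurable_funX => //.
  exact: measurable_funB.
rewrite ge0_integralZl//; last 2 first.
- move=> x _; rewrite lee_fin /patch; case: ifPn => //; rewrite mem_setE in_itv/= => /andP[x0 x1].
  by rewrite mulr_ge0// exprn_ge0// subr_ge0.
- by rewrite lee_fin exprn_ge0// ltW.
have /= <- := @EFin_beta_fun R i.+1 m.+1.
by rewrite beta_fun_fact -!EFinM mulrA -exprS mulrC.
Qed.

Lemma moment_disc (i m : nat) (r : R) : 0 < r ->
  (\int[muC]_w ((normc w ^+ 2 < r)%R%:R * (r - normc w ^+ 2) ^+ m *
                 (normc w ^+ 2) ^+ i)%:E =
   (kappa R * ((i`! * m`!)%:R / (i + m).+1`!%:R * r ^+ (i + m).+1))%:E)%E.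
Proof.
move=> r0; rewrite EFinM -(ge0_integral_beta i m r0).
(* The cutoff 0 <= t makes h nonnegative on the whole line, as [ge0_integral_radial] requires; it
   changes nothing at squared moduli. *)
pose h (t : R) : \bar R := ((0 <= t < r)%R%:R * (t ^+ i * (r - t) ^+ m))%:E.
have hE (t : R) : 0 <= t -> h t = ((t < r)%R%:R * (t ^+ i * (r - t) ^+ m))%:E.
  by rewrite /h => ->.
transitivity (\int[muC]_w h (normc w ^+ 2)%R)%E.
  by apply: eq_integral => w _; rewrite hE ?sqr_ge0//; congr EFin; ring.
rewrite ge0_integral_radial//.
- congr (_ * _)%E; apply: eq_integral => t; rewrite inE/= in_itv/= andbT => t0.
  exact: hE.
- apply/measurable_EFinP; apply: measurable_funM; last first.
    apply: measurable_funM; apply: measurable_funX => //.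
    exact: measurable_funB.
  rewrite (_ : (fun t => _) = \1_(`[0, r[%classic)).
    exact: measurable_indic.
  by apply/funext => t; rewrite indicE mem_setE in_itv.
- move=> t; rewrite lee_fin; case: andP => [[t0 tr]|]; last by rewrite mul0r.
  by rewrite mul1r mulr_ge0// exprn_ge0// subr_ge0 ltW.
Qed.

End moments.

Lemma sum_triangle (V : zmodType) (G : nat -> nat -> V) n :
  \sum_(m < n) \sum_(i < n - m) G m i = \sum_(k < n) \sum_(m < k.+1) G m (k - m)%N.
Proof.
elim: n => [|n ih]; first by rewrite !big_ord0.
rewrite [RHS]big_ord_recr /= -ih.
rewrite (eq_bigr (fun m : 'I_n.+1 => \sum_(i < n - m) G m i + G m (n - m)%N)); last first.
  by move=> m _; rewrite subSn -1?ltnS// big_ord_recr.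
rewrite big_split/=; congr (_ + _).
by rewrite big_ord_recr/= subnn big_ord0 addr0.
Qed.

Section tuple_integral.
Context d (T : measurableType d) (R : realType).
Variable mu : {sigma_finite_measure set T -> \bar R}.

Lemma measurable_tuple_cons n (F : n.+1.-tuple T -> \bar R) :
  measurable_fun setT F ->
  measurable_fun setT (fun x : T * n.-tuple T => F [tuple of x.1 :: x.2]).
Proof. by move=> mF; apply: measurableT_comp mF _; exact: measurable_tuple_of_pair. Qed.

Lemma ge0_integral_tuple_cons n (F : n.+1.-tuple T -> \bar R) :
  measurable_fun setT F -> (forall t, 0 <= F t)%E ->
  (\int[power_measure mu n.+1]_t F t =
   \int[mu]_x \int[power_measure mu n]_t F [tuple of x :: t])%E.
Proof.
move=> mF F0.
have mc := @measurable_tuple_of_pair _ T n.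
pose m := measure_function_pushforward__canonical__measure_function_Measure
  (mu \x power_measure mu n)%E mc.
transitivity (\int[m]_t F t)%E; first by apply: eq_measure_integral.
etransitivity; first by apply: (ge0_integral_pushforward mc _ measurableT mF) => t _.
rewrite preimage_setT.
apply: (@fubini_tonelli1 _ _ T (n.-tuple T) R mu (power_measure mu n)
  (F \o @tuple_of_pair _ T n)).
  exact: measurable_tuple_cons.
by move=> x; exact: F0.
Qed.

End tuple_integral.

(** * Integrals of squared moduli of polynomials in [dotC z w] over balls *)

Section ball_moment.
Variable R : realType.
Local Notation muC := (lebesgue_complex R).

Definition sqnorm d (z : Cn R d) : R := \sum_(j < d) normc (tnth z j) ^+ 2.

Lemma sqnorm_ge0 d (z : Cn R d) : 0 <= sqnorm z.
Proof. by apply: sumr_ge0 => j _; exact: sqr_ge0. Qed.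

Lemma sqnorm_cons d x (t : Cn R d) :
  sqnorm [tuple of x :: t] = normc x ^+ 2 + sqnorm t.
Proof.
rewrite /sqnorm big_ord_recl tnth0; congr (_ + _).
by apply: eq_bigr => j _; rewrite tnthS.
Qed.

Lemma dotC_cons d x (z t : Cn R d) y :
  dotC [tuple of y :: z] [tuple of x :: t] = y * x^* + dotC z t.
Proof.
rewrite /dotC big_ord_recl !tnth0; congr (_ + _).
by apply: eq_bigr => j _; rewrite !tnthS.
Qed.

Lemma measurable_sqnorm d : measurable_fun setT (@sqnorm d).
Proof.
apply: measurable_sum => j; apply: measurable_funX; apply: measurable_normc.
exact: measurable_tnth.
Qed.

Lemma measurable_dotC d dT (T : measurableType dT) (f g : T -> Cn R d) :
  measurable_fun setT f -> measurable_fun setT g ->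
  measurable_fun setT (fun x => dotC (f x) (g x)).
Proof.
move=> mf mg; apply: measurable_csum => j; apply: measurable_cmul.
  exact: measurableT_comp (measurable_tnth j) mf.
by apply: measurable_cconj; exact: measurableT_comp (measurable_tnth j) mg.
Qed.

(** Taylor's formula, with the expansion packed as a polynomial in x so that an induction hypothesis
    about polynomials applies to it. *)
Lemma horner_nderivn_poly (P : {poly R[i]}) n (y x : R[i]) : (size P <= n)%N ->
  P.[y + x] = (\poly_(m < n) (P^`N(m)).[y]).[x].
Proof.
move=> Pn; rewrite (nderiv_taylor_wide _ Pn); last exact: mulrC.
by rewrite horner_poly.
Qed.

(* Induction on the dimension for all polynomials at once: as a function of the
   last coordinates, [P] is expanded by Taylor's formula at the first term of
   [dotC]. The constant is [kappa] (the area of the disc) where one expects pi. *)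
Lemma ball_moment d (P : {poly R[i]}) n (z : Cn R d) (r : R) :
  (size P <= n)%N -> 0 < r ->
  (\int[lebesgue_Cn R d]_w ((sqnorm w < r)%R%:R * normc P.[dotC z w] ^+ 2)%:E =
   (\sum_(k < n) normc (P`_k) ^+ 2 *
      (kappa R ^+ d * (k`!%:R / (d + k)`!%:R) * r ^+ (d + k) * sqnorm z ^+ k))%:E)%E.
Proof.
elim: d P n z r => [|d ih] P n z r Pn r0.
  (* [Cn R 0] is one point with a Dirac mass and [sqnorm z] is 0 there, so only the term k = 0
     survives. *)
  transitivity (\int[\d_ ([tuple] : Cn R 0)]_w cst (normc (P`_0) ^+ 2)%:E w)%E.
    apply: eq_integral => w _ /=; congr EFin.
    by rewrite /sqnorm /dotC !big_ord0 r0 mul1r horner_coef0.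
  rewrite integral_dirac// diracE in_setT mul1e; congr EFin.
  rewrite /sqnorm big_ord0.
  case: n Pn => [|n] Pn.
    move: Pn; rewrite leqn0 size_poly_eq0 => /eqP ->.
    by rewrite big_ord0 coef0 Normc.normc0 expr0n.
  rewrite big_ord_recl [X in _ + X]big1 ?addr0 => [|k _].
    by rewrite /= expr0 !mulr1 divff ?pnatr_eq0// !mulr1.
  by rewrite [0 ^+ _]expr0n/= !mulr0.
have [y [z' ->]] : exists y (z' : Cn R d), z = [tuple of y :: z'].
  by case/tupleP: z => y z'; exists y, z'.
pose F (w : Cn R d.+1) : \bar R :=
  ((sqnorm w < r)%R%:R * normc P.[dotC [tuple of y :: z'] w] ^+ 2)%:E.
have mF : measurable_fun setT F.
  apply/measurable_EFinP; apply: measurable_funM; last first.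
    apply: measurable_funX; apply: measurable_normc; apply: measurable_horner.
    by apply: measurable_dotC.
  rewrite (_ : (fun w => _) = \1_(@sqnorm d.+1 @^-1` `]-oo, r[%classic)).
    apply: measurable_indic; rewrite -[X in measurable X]setTI.
    exact: measurable_sqnorm.
  apply/funext => w; rewrite indicE; congr (nat_of_bool _)%:R.
  by apply/idP/idP; rewrite inE/= in_itv.
have F0 w : (0 <= F w)%E by rewrite lee_fin mulr_ge0// sqr_ge0.
transitivity (\int[power_measure muC d.+1]_t F t)%E; first by [].
rewrite (ge0_integral_tuple_cons muC mF F0).
(* For first coordinate x, the slice of the ball has squared radius r - |x|^2. In the induction
   hypothesis, [c] collects the factors independent of x and [h], at |x|^2, the power of that radius
   with its cutoff. *)
pose c m := kappa R ^+ d * (m`!%:R / (d + m)`!%:R) * sqnorm z' ^+ m.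
pose h m (t : R) := (t < r)%R%:R * (r - t) ^+ (d + m).
have mh m : measurable_fun setT (h m).
  apply: measurable_funM; last by apply: measurable_funX; exact: measurable_funB.
  rewrite (_ : (fun t => _) = \1_(`]-oo, r[%classic)); first exact: measurable_indic.
  by apply/funext => t; rewrite indicE mem_setE in_itv.
have h0 m t : 0 <= h m t.
  rewrite /h; case: ltP => tr; rewrite ?mul0r// mul1r exprn_ge0// subr_ge0.
  exact: ltW.
pose g m (x : R[i]) : \bar R :=
  (h m (normc x ^+ 2) * normc (P^`N(m)).[y * x^*] ^+ 2)%:E.
have mg m : measurable_fun setT (g m).
  apply/measurable_EFinP; apply: measurable_funM; last first.
    apply: measurable_funX; apply: measurable_normc; apply: measurable_horner.
    by apply: measurable_cmul => //; exact: measurable_cconj.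
  apply: measurableT_comp (mh m) _.
  by apply: measurable_funX; exact: measurable_normc.
have g0 m x : (0 <= g m x)%E by rewrite lee_fin mulr_ge0// sqr_ge0.
have c0 m : 0 <= c m.
  rewrite /c !mulr_ge0 ?exprn_ge0 ?sqnorm_ge0 ?divr_ge0 ?ler0n//.
  exact/ltW/kappa_gt0.
transitivity (\int[muC]_x \sum_(m < n) (c m)%:E * g m x)%E.
  apply: eq_integral => x _; rewrite -/(lebesgue_Cn R d).
  have [xr|rx] := ltP (normc x ^+ 2) r; last first.
    rewrite integral0_eq => [|t _].
      by rewrite big1// => m _; rewrite /g /h ltNge rx/= !mul0r mule0.
    rewrite /F sqnorm_cons ltNge (le_trans rx) ?mul0r//.
    by rewrite lerDl sqnorm_ge0.
  pose Q := \poly_(m < n) (P^`N(m)).[y * x^*].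
  have := ih Q n z' (r - normc x ^+ 2) (size_poly _ _).
  rewrite subr_gt0 => /(_ xr) ihQ; etransitivity.
    etransitivity; last exact: ihQ.
    apply: eq_integral => t _; rewrite /F sqnorm_cons dotC_cons.
    by rewrite (horner_nderivn_poly _ _ Pn) -ltrBrDl.
  under [RHS]eq_bigr do rewrite -EFinM.
  rewrite sumEFin; congr EFin; apply: eq_bigr => m _.
  by rewrite coef_poly ltn_ord /c /h xr mul1r; ring.
rewrite ge0_integral_sum//; last 2 first.
- by move=> m; apply: measurable_funeM; exact: mg.
- by move=> m x _; apply: mule_ge0; [rewrite lee_fin; exact: c0|exact: g0].
pose G m i := normc (P`_(m + i)) ^+ 2 * (normc y ^+ 2) ^+ i *
  ('C(m + i, m)%:R ^+ 2 * (kappa R *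
    ((i`! * (d + m)`!)%:R / (i + (d + m)).+1`!%:R * r ^+ (i + (d + m)).+1))).
transitivity (\sum_(m < n) (\sum_(i < n - m) c m * G m i)%:E)%E.
  apply: eq_bigr => m _.
  etransitivity.
    by apply: (ge0_integralZl muC measurableT (mg m)) => [x _|];
      [exact: g0|rewrite lee_fin; exact: c0].
  rewrite -mulr_sumr [RHS]EFinM; congr (_ * _)%E.
  have sm : (size (P^`N(m)) <= n - m)%N.
    apply/leq_sizeP => i; rewrite leq_subLR => ni.
    by rewrite coef_nderivn nth_default ?mul0rn// (leq_trans Pn).
  rewrite (ge0_integral_radial_horner y (mh m) (h0 m) sm) -sumEFin.
  apply: eq_bigr => i _; rewrite /h moment_disc// -EFinM; congr EFin.
  rewrite coef_nderivn -[X in normc X]mulr_natr Normc.normcM.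
  have -> : normc ('C(m + i, m)%:R : R[i]) = 'C(m + i, m)%:R.
    by rewrite -(rmorph_nat (real_complex R)) /= expr0n addr0 sqrtr_sqr ger0_norm.
  by rewrite /G; ring.
rewrite sumEFin; congr EFin.
rewrite (sum_triangle (fun m i => c m * G m i)); apply: eq_bigr => k _.
rewrite sqnorm_cons exprDn.
rewrite !mulr_sumr; apply: eq_bigr => m _.
have mk : (m <= k)%N by rewrite -ltnS.
have -> : G m (k - m)%N = normc (P`_k) ^+ 2 * (normc y ^+ 2) ^+ (k - m)%N *
    ('C(k, m)%:R ^+ 2 * (kappa R * (((k - m)`! * (d + m)`!)%:R /
      (d.+1 + k)`!%:R * r ^+ (d.+1 + k)))).
  by rewrite /G subnKC// addnCA subnK// -addSn.
(* One of the two factors C(k, m) in [G] joins m! (k-m)! to give k!; the other is the coefficient in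
   the binomial expansion of (|y|^2 + |z'|^2)^k. *)
have kE : k`!%:R = 'C(k, m)%:R * m`!%:R * (k - m)`!%:R :> R.
  by rewrite -!natrM -mulnA bin_fact.
have f1 : ((d + m)`!%:R : R) != 0 by rewrite pnatr_eq0 -lt0n fact_gt0.
have f2 : ((d.+1 + k)`!%:R : R) != 0 by rewrite pnatr_eq0 -lt0n fact_gt0.
rewrite /c kE natrM -[_ *+ 'C(k, m)]mulr_natr [kappa R ^+ d.+1]exprS.
move: f1 f2; move: (_`!%:R) (_ ^+ (d.+1 + k)) (_`!%:R) => q1 rk q2 f1 f2.
by field; rewrite f1 f2.
Qed.

End ball_moment.

(** * The binomial series *)

Section binomial_series.
Variable R : realType.
Implicit Types (b t : R) (x z : R[i]).
Local Notation Re := complex.Re.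
Local Notation Im := complex.Im.

(** Real and imaginary parts are differentiated separately along the real axis, because the mean
    value theorem will be applied to a real function of t. *)
Lemma is_derive_Re_horner (Z : {poly R[i]}) t :
  is_derive t 1 (fun t => Re Z.[t%:C]) (Re Z^`().[t%:C]).
Proof.
elim/poly_ind: Z t => [|Z c ih] t.
  rewrite deriv0 horner0; under eq_fun do rewrite horner0; exact: is_derive_cst.
rewrite derivD derivM derivX derivC addr0 mulr1 hornerD hornerM hornerX.
under eq_fun do rewrite hornerMXaddC.
have E1 u (s : R) (v : R[i]) : Re (u * s%:C + v) = Re u * s + Re v.
  by case: u => ? ?; case: v => ? ? /=; rewrite mulr0 subr0.
under eq_fun do rewrite E1.
rewrite E1; have h1 := is_deriveM (ih t) (is_derive_id t 1).
have h2 := is_deriveD h1 (is_derive_cst (Re c) t 1).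
apply: (is_derive_eq h2).
by rewrite addr0 -[_%:A]/(_ * 1) -[_ *: _]/(_ * _) mulr1 addrC mulrC.
Qed.

Lemma is_derive_Im_horner (Z : {poly R[i]}) t :
  is_derive t 1 (fun t => Im Z.[t%:C]) (Im Z^`().[t%:C]).
Proof.
elim/poly_ind: Z t => [|Z c ih] t.
  rewrite deriv0 horner0; under eq_fun do rewrite horner0; exact: is_derive_cst.
rewrite derivD derivM derivX derivC addr0 mulr1 hornerD hornerM hornerX.
under eq_fun do rewrite hornerMXaddC.
have E1 u (s : R) (v : R[i]) : Im (u * s%:C + v) = Im u * s + Im v.
  by case: u => ? ?; case: v => ? ? /=; rewrite mulr0 add0r.
under eq_fun do rewrite E1.
rewrite E1; have h1 := is_deriveM (ih t) (is_derive_id t 1).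
have h2 := is_deriveD h1 (is_derive_cst (Im c) t 1).
apply: (is_derive_eq h2).
by rewrite addr0 -[_%:A]/(_ * 1) -[_ *: _]/(_ * _) mulr1 addrC mulrC.
Qed.

(** The coefficient (b)_k / k! of x^k in (1 - x)^(-b). *)
Definition binom_coef b k : R := \prod_(i < k) ((b + i%:R) / i.+1%:R).

Lemma binom_coefS b k : k.+1%:R * binom_coef b k.+1 = (b + k%:R) * binom_coef b k.
Proof.
rewrite /binom_coef big_ord_recr/=; set q := \prod_(_ < _) _.
by rewrite mulrCA [_ / _]mulrC mulVKf ?pnatr_eq0// mulrC.
Qed.

(** Coefficientwise form of the fact that the derivative of (1 - x)^(-b) is b (1 - x)^(-b-1). *)
Lemma binom_coefSl b k : k.+1%:R * binom_coef b k.+1 = b * binom_coef (b + 1) k.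
Proof.
elim: k => [|k ih]; first by rewrite binom_coefS /binom_coef !big_ord0 addr0.
apply: (@mulfI _ k.+1%:R); first by rewrite pnatr_eq0.
by rewrite binom_coefS mulrCA ih mulrCA [RHS]mulrCA binom_coefS -natr1; ring.
Qed.

Lemma binom_coef_ge0 b k : 0 <= b -> 0 <= binom_coef b k.
Proof. by move=> b0; apply: prodr_ge0 => i _; rewrite divr_ge0// addr_ge0. Qed.

Lemma binom_coef_geometric b r : 0 <= b -> 0 <= r -> r < 1 ->
  exists C q : R, [/\ 0 <= C, 0 < q, q < 1 & forall k, binom_coef b k * r ^+ k <= C * q ^+ k].
Proof.
move=> b0 r0 r1; pose q := (1 + r) / 2.
have q0 : 0 < q by rewrite /q; lra.
have q1 : q < 1 by rewrite /q; lra.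
have rq : r < q by rewrite /q; lra.
(* Ratio test: for k >= K one has b r <= b < k (q - r), so the ratio (b + k) r / (k + 1) of
   consecutive terms is at most q. The constant C absorbs the terms up to K. *)
pose K := (Num.truncn (b / (q - r))).+1.
pose C := \sum_(k < K.+1) binom_coef b k * r ^+ k / q ^+ k.
have t0 k : 0 <= binom_coef b k * r ^+ k / q ^+ k.
  by rewrite divr_ge0 ?exprn_ge0 ?(ltW q0)// mulr_ge0 ?exprn_ge0// binom_coef_ge0.
exists C, q; split => //; first exact: sumr_ge0.
have small k : (k <= K)%N -> binom_coef b k * r ^+ k <= C * q ^+ k.
  rewrite -ltnS => kK; rewrite -ler_pdivrMr ?exprn_gt0//.
  rewrite /C (bigD1 (Ordinal kK))//= lerDl; exact: sumr_ge0.
elim=> [|k ih]; first exact: small.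
have [/small//|Kk] := leqP k.+1 K.
have kq : (b + k%:R) * r <= q * k.+1%:R.
  have : b / (q - r) < k%:R by rewrite (lt_le_trans (truncnS_gt _))// ler_nat -ltnS.
  rewrite ltr_pdivrMr ?subr_gt0// -natr1.
  have : b * r <= b by rewrite ler_piMr// ltW.
  nra.
rewrite !exprS [leRHS]mulrA [leRHS]mulrAC.
apply: (@le_trans _ _ (binom_coef b k * r ^+ k * q)); last by rewrite ler_pM2r.
rewrite -(@ler_pM2l _ k.+1%:R)// !mulrA binom_coefS.
rewrite [leLHS](_ : _ = (binom_coef b k * r ^+ k) * ((b + k%:R) * r)); last by ring.
rewrite [leRHS](_ : _ = (binom_coef b k * r ^+ k) * (q * k.+1%:R)); last by rewrite /q; field.
by rewrite ler_wpM2l// mulr_ge0 ?exprn_ge0// binom_coef_ge0.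
Qed.

(** The variable is the position t on the segment from 0 to x, with x placed in the coefficients;
    the value at t = 1 is the partial sum at x. *)
Definition binom_poly b x N : {poly R[i]} := \poly_(k < N) ((binom_coef b k)%:C * x ^+ k).

Lemma binom_polyS b x N : binom_poly b x N.+1 =
  binom_poly b x N + ((binom_coef b N)%:C * x ^+ N) *: 'X^N.
Proof. by rewrite /binom_poly !poly_def big_ord_recr. Qed.

(* (1 - tx)^-b solves (1 - tx) P' = b x P; its partial sums do so up to the last
   term. *)
Lemma binom_poly_ode b x N z :
  (1 - z * x) * (binom_poly b x N.+1)^`().[z] =
  b%:C * x * (binom_poly b x N.+1).[z] -
  (N.+1%:R * binom_coef b N.+1)%:C * x ^+ N.+1 * z ^+ N.
Proof.
elim: N => [|N ih].
  rewrite binom_polyS /binom_poly poly_def big_ord0 add0r expr0 alg_polyC.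
  rewrite derivC horner0 hornerC binom_coefS /binom_coef big_ord0.
  by rewrite !expr0 addr0 !mulr1 expr1 mulr0 subrr.
rewrite binom_polyS derivD derivZ derivXn !(hornerD, hornerZ, hornerMn, hornerXn).
rewrite mulrDr ih [in RHS]binom_coefS.
have e1 c : (N.+1%:R * c)%:C = N.+1%:R * c%:C :> R[i] by rewrite rmorphM rmorph_nat.
have e2 c : ((b + N.+1%:R) * c)%:C = (b%:C + N.+1%:R) * c%:C :> R[i].
  by rewrite rmorphM rmorphD rmorph_nat.
rewrite e1 e2 -[z ^+ N *+ N.+1]mulr_natl (exprSr x N.+1) (exprSr z N) /=.
move: (_.[z]) (binom_coef b N.+1)%:C (x ^+ N.+1) (z ^+ N) (N.+1%:R) => P a xN zN n.
ring.
Qed.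

(* Used with [d] = |1 - tx|^(2b - 2), so that the left-hand side is the derivative
   of |P|^2 |1 - tx|^(2b) when [u], [v] are the values of P and P'. *)
Lemma ode_energy b t (d : R) (u v x : R[i]) :
  d * (2 * b * (Re u ^+ 2 + Im u ^+ 2) * ((1 - t * Re x) * (- Re x) + t * Im x * Im x) +
    ((1 - t * Re x) ^+ 2 + (t * Im x) ^+ 2) * (2 * (Re u * Re v + Im u * Im v))) =
  d * (- 2 * Re (u^* * (b%:C * x * u - (1 - t%:C * x) * v) * (1 - t%:C * x)^*)).
Proof.
rewrite -[u^*]/(conjc u) -[(1 - t%:C * x)^*]/(conjc (1 - t%:C * x)).
by case: u => ur ui; case: v => vr vi; case: x => xr xi /=; ring.
Qed.

Lemma norm_Re_le_normc z : `|Re z| <= normc z.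
Proof.
by case: z => p q; rewrite /= -[leLHS]sqrtr_sqr ler_wsqrtr// lerDl sqr_ge0.
Qed.

(** For an exact solution of the differential equation |P|^2 |1 - tx|^(2b) would be constant. For a
    partial sum, [ode_energy] leaves in the derivative only the defect [e], the last term of
    [binom_poly_ode]. *)
Lemma binom_derive_bound b x N t : 0 < b -> normc x < 1 -> 0 <= t <= 1 ->
  let D t := (1 - t * Re x) ^+ 2 + (t * Im x) ^+ 2 in
  let u t := (binom_poly b x N.+1).[t%:C] in
  0 < D t ->
  exists2 dH, is_derive t 1 (fun t => (Re (u t) ^+ 2 + Im (u t) ^+ 2) * D t `^ b) dH &
    `|dH| <= D t `^ (b - 1) * (2 * (normc (u t) *
      (`|N.+1%:R * binom_coef b N.+1| * normc x ^+ N.+1) * Num.sqrt (D t))).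
Proof.
move=> b0 x1 /andP[t0 t1] D u D0.
pose v := (binom_poly b x N.+1)^`().[t%:C].
pose e := (N.+1%:R * binom_coef b N.+1)%:C * x ^+ N.+1 * t%:C ^+ N.
have ode : (1 - t%:C * x) * v = b%:C * x * u t - e := binom_poly_ode b x N t%:C.
have dQ : is_derive t 1 (fun t => Re (u t) ^+ 2 + Im (u t) ^+ 2)
    (2 * (Re (u t) * Re v + Im (u t) * Im v)).
  have hR := is_derive_Re_horner (binom_poly b x N.+1) t.
  have hI := is_derive_Im_horner (binom_poly b x N.+1) t.
  apply: (is_derive_eq (is_deriveD (is_deriveM hR hR) (is_deriveM hI hI))).
  by rewrite -![_ *: _]/(_ * _); ring.
have dD : is_derive t 1 D (2 * ((1 - t * Re x) * (- Re x) + t * Im x * Im x)).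
  have h1 : is_derive t 1 (fun t => 1 - t * Re x) (- Re x).
    apply: (is_derive_eq (is_deriveB (is_derive_cst (1 : R) t 1)
      (is_deriveM (is_derive_id t 1) (is_derive_cst (Re x) t 1)))).
    by rewrite scaler0 add0r -[_%:A]/(_ * 1) mulr1 ?sub0r ?add0r.
  have h2 : is_derive t 1 (fun t => t * Im x) (Im x).
    apply: (is_derive_eq (is_deriveM (is_derive_id t 1) (is_derive_cst (Im x) t 1))).
    by rewrite scaler0 add0r -[_%:A]/(_ * 1) mulr1.
  apply: (is_derive_eq (is_deriveD (is_deriveM h1 h1) (is_deriveM h2 h2))).
  by rewrite -![_ *: _]/(_ * _); ring.
have dDb := is_derive1_comp (is_derive1_powR b D0) dD.
eexists; first exact: is_deriveM dQ dDb.
rewrite -![_ *: _]/(_ * _) /= -(mulr_powRB1 (ltW D0) b0).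
set d := D t `^ (b - 1).
pose s := (u t)^* * e * (1 - t%:C * x)^*.
rewrite [X in `|X| <= _](_ : _ = d * (- 2 * Re s)); last first.
  rewrite /s (_ : e = b%:C * x * u t - (1 - t%:C * x) * v); last by rewrite ode; ring.
  by rewrite -ode_energy /D; ring.
rewrite normrM ger0_norm ?powR_ge0// ler_wpM2l ?powR_ge0//.
rewrite normrM normrN (ger0_norm (ler0n R 2)) ler_wpM2l//.
apply: le_trans (norm_Re_le_normc _) _; rewrite !Normc.normcM !normc_conj.
have -> : normc (1 - t%:C * x) = Num.sqrt (D t).
  by rewrite /D; case: (x) => xr xi /=; congr Num.sqrt; ring.
rewrite ler_wpM2r ?sqrtr_ge0// ler_wpM2l ?normc_ge0//.
rewrite !normcX !normc_real -[leRHS]mulr1 ler_wpM2l//.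
  by rewrite mulr_ge0// exprn_ge0// normc_ge0.
by rewrite ger0_norm// exprn_ile1.
Qed.

Lemma sqr_normc_ReIm z : normc z ^+ 2 = Re z ^+ 2 + Im z ^+ 2.
Proof. by case: z => p q; rewrite sqr_normcE. Qed.

Lemma normc_sum n (F : 'I_n -> R[i]) : normc (\sum_(i < n) F i) <= \sum_(i < n) normc (F i).
Proof.
elim: n F => [|n ih] F; first by rewrite !big_ord0 Normc.normc0.
rewrite !big_ord_recl; apply: le_trans (le_normcD _ _) _; rewrite lerD2l; exact: ih.
Qed.

End binomial_series.

(** * Convergence of the squared moduli of the partial sums *)

Section binomial_limit.
Variable R : realType.
Implicit Types (b t : R) (x z : R[i]).
Local Notation Re := complex.Re.
Local Notation Im := complex.Im.

Lemma normc_ge1B x t : 0 <= t <= 1 -> 1 - normc x <= normc (1 - t%:C * x).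
Proof.
move=> /andP[t0 t1].
have := le_normcD (1 - t%:C * x) (t%:C * x).
rewrite subrK Normc.normc1 Normc.normcM => h.
rewrite normc_real ger0_norm// in h; have := normc_ge0 x; nra.
Qed.

Lemma normc_le2 x t : normc x < 1 -> 0 <= t <= 1 -> normc (1 - t%:C * x) <= 2.
Proof.
move=> x1 /andP[t0 t1].
have := le_normcD 1 (- (t%:C * x)).
rewrite normcN Normc.normc1 Normc.normcM => h.
rewrite normc_real ger0_norm// in h; have := normc_ge0 x; nra.
Qed.

Lemma binom_poly_bound b x : 0 <= b -> normc x < 1 ->
  exists2 M, 0 <= M & forall N t, 0 <= t <= 1 -> normc (binom_poly b x N).[t%:C] <= M.
Proof.
move=> b0 x1; have [C [q [C0 q0 q1 le]]] := binom_coef_geometric b0 (normc_ge0 x) x1.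
have q1' : 0 < 1 - q by rewrite subr_gt0.
exists (C / (1 - q)); first by rewrite divr_ge0// ltW.
move=> N t /andP[t0 t1].
rewrite horner_poly; apply: le_trans (normc_sum _) _.
apply: (@le_trans _ _ (\sum_(k < N) C * q ^+ k)).
  apply: ler_sum => k _; rewrite !Normc.normcM !normcX.
  rewrite !normc_real !ger0_norm ?binom_coef_ge0//.
  apply: le_trans (le k).
  rewrite ler_piMr ?mulr_ge0 ?exprn_ge0 ?normc_ge0 ?binom_coef_ge0//.
  by rewrite exprn_ile1.
rewrite -mulr_sumr ler_wpM2l// -(ler_pM2l q1') mulfV ?gt_eqF//.
rewrite -opprB mulNr -subrX1 opprB gerBl exprn_ge0// ltW//.
Qed.

(* |P|^2 |1 - tx|^(2b) equals 1 at t = 0 and its derivative on [0,1] tends to 0. *)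
Lemma binom_poly_cvg b x : 0 < b -> normc x < 1 ->
  normc (binom_poly b x N).[1] ^+ 2 @[N --> \oo] --> (normc (1 - x) `^ (2 * b))^-1.
Proof.
move=> b0 x1; set r := normc x.
have r0 : 0 <= r by exact: normc_ge0.
have [M M0 leM] := binom_poly_bound (ltW b0) x1.
(* The defect carries (N+1) [binom_coef b N.+1], which is b [binom_coef (b + 1) N] by
   [binom_coefSl]; hence the geometric bound with parameter b + 1. *)
have b1 : 0 <= b + 1 by rewrite addr_ge0// ltW.
have [C [q [C0 q0 q1 leC]]] := binom_coef_geometric b1 r0 x1.
pose D t := (1 - t * Re x) ^+ 2 + (t * Im x) ^+ 2.
have DE t : D t = normc (1 - t%:C * x) ^+ 2.
  by rewrite sqr_normc_ReIm /D; case: (x) => xr xi /=; ring.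
have r1 : 0 < 1 - r by rewrite subr_gt0.
have Dge t : 0 <= t <= 1 -> (1 - r) ^+ 2 <= D t.
  move=> t01; rewrite DE lerXn2r ?nnegrE ?normc_ge0 ?(ltW r1)//; exact: normc_ge1B.
have D0 t : 0 <= t <= 1 -> 0 < D t.
  by move=> /Dge; apply: lt_le_trans; rewrite exprn_gt0.
have Dle t : 0 <= t <= 1 -> D t <= 4.
  move=> t01; rewrite DE (_ : 4 = 2 ^+ 2); last by ring.
  by rewrite ler_sqr ?nnegrE ?normc_ge0// normc_le2.
(* As b - 1 may have either sign, D^(b-1) is bounded as D^b / D, using D <= 4 above and D >= (1 -
   r)^2 below. *)
pose K0 := 4 `^ b / (1 - r) ^+ 2.
have K00 : 0 <= K0 by rewrite divr_ge0 ?powR_ge0// exprn_ge0// ltW.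
have Dpow t : 0 <= t <= 1 -> D t `^ (b - 1) <= K0.
  move=> t01; rewrite powRB; last by apply/implyP => _; rewrite gt_eqF// D0.
  rewrite powRr1 ?(ltW (D0 _ t01))// /K0.
  apply: ler_pM; rewrite ?powR_ge0 ?invr_ge0 ?(ltW (D0 _ t01))//.
    apply: ge0_ler_powR; rewrite ?nnegrE ?(ltW (D0 _ t01)) ?(ltW b0)//.
    exact: Dle.
  by rewrite lef_pV2 ?posrE ?D0 ?exprn_gt0// Dge.
pose W := normc (1 - x) `^ (2 * b).
have x01 : 0 < normc (1 - x).
  have := @normc_ge1B x 1; rewrite ler01 lexx mul1r => /(_ isT).
  exact: lt_le_trans.
have W0 : 0 < W by exact: powR_gt0.
pose H N t := (Re (binom_poly b x N.+1).[t%:C] ^+ 2 +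
  Im (binom_poly b x N.+1).[t%:C] ^+ 2) * D t `^ b.
have H1 N : H N 1 = normc (binom_poly b x N.+1).[1] ^+ 2 * W.
  rewrite /H sqr_normc_ReIm; congr (_ * _).
  by rewrite DE mul1r /W powRrM powR_mulrn ?normc_ge0.
have H0 N : H N 0 = 1.
  rewrite /H horner_coef0 coef_poly /= /D !mul0r !mulr0 addr0 !subr0 /binom_coef big_ord0.
  by rewrite !expr1n expr0n/= !addr0 mulr1 expr1n powR1 mulr1.
pose K := K0 * (2 * (M * (b * C) * 2)) / W.
have key N : `|normc (binom_poly b x N.+1).[1] ^+ 2 - W^-1| <= K * q ^+ N.
  have dH t : 0 <= t <= 1 -> is_derive t 1 (H N) ('D_1 (H N) t) /\
      `|'D_1 (H N) t| <= K0 * (2 * (M * (b * C) * 2)) * q ^+ N.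
    move=> t01; have [dh hd hb] := binom_derive_bound N b0 x1 t01 (D0 _ t01).
    have dhE : 'D_1 (H N) t = dh by apply: derive_val; exact: hd.
    rewrite dhE; split => //; apply: le_trans hb _.
    rewrite -[leRHS]mulrA; apply: ler_pM; rewrite ?powR_ge0//.
    - by rewrite !mulr_ge0 ?normc_ge0 ?sqrtr_ge0 ?exprn_ge0.
    - exact: Dpow.
    rewrite -[leRHS]mulrA ler_wpM2l// [leRHS]mulrAC.
    apply: ler_pM; rewrite ?sqrtr_ge0 ?mulr_ge0 ?exprn_ge0 ?normc_ge0//.
      rewrite -[leRHS]mulrA; apply: ler_pM; rewrite ?mulr_ge0 ?exprn_ge0 ?normc_ge0//.
        exact: leM.
      rewrite ger0_norm ?mulr_ge0 ?binom_coef_ge0 ?(ltW b0)//.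
      rewrite binom_coefSl -!mulrA ler_wpM2l ?(ltW b0)//.
      apply: le_trans (leC N); rewrite ler_wpM2l ?binom_coef_ge0//.
      by rewrite exprS ler_piMl ?exprn_ge0// ltW.
    have -> : 2 = Num.sqrt 4 :> R by rewrite (_ : 4 = 2 ^+ 2) ?sqrtr_sqr ?ger0_norm//; ring.
    by rewrite ler_wsqrtr// Dle.
  have hd t : t \in `]0, 1[%R -> is_derive t 1 (H N) ('D_1 (H N) t).
    by rewrite in_itv/= => /andP[t0 t1]; apply dH; rewrite !ltW.
  have hc : {within `[0, 1], continuous (H N)}.
    apply: derivable_within_continuous => t; rewrite in_itv/= => /dH[{}hd _].
    exact: ex_derive.
  have [c] := MVT_segment ler01 hd hc.
  rewrite in_itv/= => /dH[_ hb]; rewrite H0 H1 subr0 mulr1 => E.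
  rewrite /K [leRHS]mulrAC ler_pdivlMr// -[X in _ * X]gtr0_norm// -normrM.
  by rewrite mulrBl mulVf ?gt_eqF// E.
rewrite -cvg_shiftS.
have Kq : K * q ^+ N @[N --> \oo] --> (0 : R).
  rewrite -[X in _ --> X](mulr0 K); apply: cvgM; first exact: cvg_cst.
  by apply: cvg_expr; rewrite gtr0_norm.
apply: (@squeeze_cvgr _ _ _ _ (fun N => W^-1 - K * q ^+ N) (fun N => W^-1 + K * q ^+ N)).
- by apply: nearW => N; have := key N; rewrite ler_distl.
- by rewrite -[X in _ --> X]subr0; apply: cvgB => //; exact: cvg_cst.
- by rewrite -[X in _ --> X]addr0; apply: cvgD => //; exact: cvg_cst.
Qed.

End binomial_limit.

(** * The kernel bound *)

Section gauss_gamma.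
Variable R : realType.

(** The two hypotheses of [gauss_sum_le] hold: G >= 1 by log-convexity of Gamma, and the recursion
    by its functional equation. *)
Lemma gauss_sum_le_Gamma (b c : R) n : 0 < b -> 2 * b < c ->
  gauss_sum b c n <= Gamma c * Gamma (c - 2 * b) / Gamma (c - b) ^+ 2.
Proof.
move=> b0 bc; pose G (x : R) := Gamma x * Gamma (x - 2 * b) / Gamma (x - b) ^+ 2.
suff [G1 GS] : (forall x, 2 * b < x -> 1 <= G x) /\
    (forall x, 2 * b < x -> x * (x - 2 * b) * G x = (x - b) ^+ 2 * G (x + 1)).
  exact: (gauss_sum_le n b0 bc G1 GS).
split=> x bx.
  have xb : 0 < x - b by lra.
  rewrite /G ler_pdivlMr ?exprn_gt0 ?Gamma_gt0// mul1r.
  by apply: Gamma_log_convex => //; lra.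
have x0 : 0 < x by lra.
have xb : 0 < x - b by lra.
have xbb : 0 < x - 2 * b by lra.
rewrite /G (_ : x + 1 - 2 * b = (x - 2 * b) + 1); last by ring.
rewrite (_ : x + 1 - b = (x - b) + 1); last by ring.
rewrite !GammaS//.
have := Gamma_gt0 xb; move: (Gamma x) (Gamma (x - 2 * b)) (Gamma (x - b)) => p q r r0.
by field; rewrite !gt_eqF.
Qed.

(** Because (d+1)_k = (d+k)! / d!; this is how c = d + 1 enters. *)
Lemma gauss_term_binom_coef (b : R) d k :
  binom_coef b k ^+ 2 * (d`!%:R * k`!%:R / (d + k)`!%:R) = gauss_term b d.+1%:R k.
Proof.
elim: k => [|k ih].
  by rewrite /binom_coef /gauss_term !big_ord0 addn0 expr1n mulr1 mul1r divff.
rewrite gauss_termS -ih addnS !factS !natrM.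
have -> : binom_coef b k.+1 = (b + k%:R) * binom_coef b k / k.+1%:R.
  by rewrite -binom_coefS mulrAC divff ?mul1r// pnatr_eq0.
have -> : d.+1%:R + k%:R = (d + k).+1%:R :> R by rewrite -natrD addSn.
have n1 : (k.+1%:R : R) != 0 by rewrite pnatr_eq0.
have n2 : ((d + k).+1%:R : R) != 0 by rewrite pnatr_eq0.
have n3 : ((d + k)`!%:R : R) != 0 by rewrite pnatr_eq0 -lt0n fact_gt0.
move: n1 n2 n3.
move: (k.+1%:R : R) ((d + k).+1%:R : R) ((d + k)`!%:R : R) => p q r p0 q0 r0.
by field; rewrite p0 q0 r0.
Qed.

End gauss_gamma.

(** * Uniform bound for the integral of the kernel in one variable *)

Section kernel_bound.
Variables (R : realType) (d : nat).
Local Notation L := (lebesgue_Cn R d).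
Local Notation B := (@unit_ball R d).
Local Notation V := (fine (L B)).

Lemma integral_unit_ball (f : Cn R d -> R) :
  (\int[L]_(w in B) (f w)%:E = \int[L]_w ((sqnorm w < 1)%R%:R * f w)%:E)%E.
Proof.
rewrite integral_mkcond; apply: eq_integral => w _; rewrite /patch.
case: ifPn => [/set_mem|/negP wB].
  by rewrite /unit_ball /mkset -/(sqnorm w) => ->; rewrite mul1r.
rewrite (_ : (sqnorm w < 1) = false) ?mul0r//.
by apply/negP => h; apply: wB; exact: mem_set.
Qed.

(** The moment formula for the constant polynomial 1. *)
Lemma lebesgue_unit_ball : L B = (kappa R ^+ d / d`!%:R)%:E.
Proof.
have := @ball_moment R d 1 1 [tuple 0 | j < d] 1; rewrite size_poly1 => /(_ isT ltr01).
rewrite big_ord1 (_ : (1 : {poly R[i]})`_ord0 = 1) ?coef1// Normc.normc1.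
rewrite !expr1n addn0 fact0 expr0 !mulr1 mul1r div1r => <-.
under eq_integral do rewrite hornerC Normc.normc1 expr1n.
rewrite -(integral_unit_ball (fun=> 1)).
by rewrite integral_cst ?mul1e//; exact: measurable_unit_ball.
Qed.

Lemma volume_unit_ball : V = kappa R ^+ d / d`!%:R.
Proof. by rewrite lebesgue_unit_ball. Qed.

Lemma volume_unit_ball_gt0 : 0 < V.
Proof.
by rewrite volume_unit_ball divr_gt0 ?exprn_gt0 ?kappa_gt0// ltr0n fact_gt0.
Qed.

Lemma dv_unit_ball : dv R d B = 1%E.
Proof.
transitivity ((V^-1)%:E * L (B `&` B))%E; first by [].
rewrite setIid lebesgue_unit_ball -EFinM mulVf//.
by rewrite gt_eqF// -volume_unit_ball volume_unit_ball_gt0.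
Qed.

Lemma ge0_integral_dv (h : Cn R d -> \bar R) :
  measurable_fun setT h -> (forall w, 0 <= h w)%E ->
  (\int[dv R d]_(w in B) h w = (V^-1)%:E * \int[L]_(w in B) h w)%E.
Proof.
move=> mh h0; have mB := @measurable_unit_ball R d.
have mhB : measurable_fun setT (h \_ B).
  by apply/(measurable_restrictT h) => //; exact: measurable_funTS.
have hB0 w : (0 <= (h \_ B) w)%E by apply: erestrict_ge0.
rewrite integral_mkcond.
rewrite /dv ge0_integral_mscale// ge0_integral_mrestr//; congr (_ * _)%E.
by rewrite -integral_mkcondr setIid.
Qed.

Lemma ge0_integral_dvT (h : Cn R d -> \bar R) :
  measurable_fun setT h -> (forall w, 0 <= h w)%E ->
  (\int[dv R d]_w h w = \int[dv R d]_(w in B) h w)%E.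
Proof.
move=> mh h0; rewrite ge0_integral_dv// /dv ge0_integral_mscale//.
by rewrite ge0_integral_mrestr.
Qed.

(** Termwise AM-GM, |z_j w_j| <= (|z_j|^2 + |w_j|^2) / 2, takes the place of Cauchy-Schwarz. *)
Lemma normc_dotC_lt1 (z w : Cn R d) : sqnorm z < 1 -> sqnorm w < 1 ->
  normc (dotC z w) < 1.
Proof.
move=> z1 w1; apply: (@le_lt_trans _ _ ((sqnorm z + sqnorm w) / 2)); last lra.
apply: le_trans (normc_sum _) _.
rewrite /sqnorm -big_split/= mulr_suml; apply: ler_sum => j _.
rewrite Normc.normcM normc_conj.
by have := sqr_ge0 (normc (tnth z j) - normc (tnth w j)); nra.
Qed.

Lemma dotC_swap (z w : Cn R d) : normc (1 - dotC z w) = normc (1 - dotC w z).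
Proof.
rewrite -normc_conj rmorphB rmorph1 rmorph_sum/=; congr (normc (1 - _)).
apply: eq_bigr => j _; rewrite rmorphM/= mulrC; congr (_ * _).
exact: conjcK.
Qed.

(** Dividing the moment formula by the volume cancels kappa^d and leaves [gauss_term] times |z|^(2k)
    <= 1; the latter is the only loss, and makes the bound uniform in z. *)
Lemma integral_binom_poly (b : R) N (z : Cn R d) : sqnorm z < 1 ->
  (\int[dv R d]_(w in B) (normc (binom_poly b (dotC z w) N).[1] ^+ 2)%:E <=
   (gauss_sum b d.+1%:R N)%:E)%E.
Proof.
move=> z1; pose P : {poly R[i]} := \poly_(k < N) (binom_coef b k)%:C.
have PE x : (binom_poly b x N).[1] = P.[x].
  by rewrite !horner_poly; apply: eq_bigr => k _; rewrite expr1n mulr1.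
under eq_integral do rewrite PE.
have mP : measurable_fun setT (fun w : Cn R d => normc P.[dotC z w] ^+ 2).
  apply: measurable_funX; apply: measurable_normc; apply: measurable_horner.
  by apply: measurable_dotC.
rewrite ge0_integral_dv; last 2 first.
- exact/measurable_EFinP.
- by move=> w; rewrite lee_fin sqr_ge0.
rewrite integral_unit_ball (ball_moment z (size_poly _ _))// -EFinM lee_fin.
rewrite mulr_sumr; apply: ler_sum => k _.
rewrite coef_poly ltn_ord.
rewrite normc_real -normrX (ger0_norm (sqr_ge0 _)) expr1n mulr1 -gauss_term_binom_coef.
rewrite volume_unit_ball.
have k0 : kappa R ^+ d != 0 by rewrite expf_neq0// gt_eqF// kappa_gt0.
have n1 : (d`!%:R : R) != 0 by rewrite pnatr_eq0 -lt0n fact_gt0.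
have n3 : ((d + k)`!%:R : R) != 0 by rewrite pnatr_eq0 -lt0n fact_gt0.
rewrite [leLHS](_ : _ =
    binom_coef b k ^+ 2 * (d`!%:R * k`!%:R / (d + k)`!%:R) * sqnorm z ^+ k).
  rewrite ler_piMr//; last by rewrite exprn_ile1 ?sqnorm_ge0// ltW.
  by rewrite mulr_ge0 ?sqr_ge0// divr_ge0// mulr_ge0.
by field; rewrite n1 n3 k0.
Qed.

Lemma measurable_dotC_kernel (beta : R) dT (T : measurableType dT) (f g : T -> Cn R d) :
  measurable_fun setT f -> measurable_fun setT g ->
  measurable_fun setT (fun x => (normc (1 - dotC (f x) (g x)) `^ beta)^-1).
Proof.
move=> mf mg.
have mn : measurable_fun setT (fun x => normc (1 - dotC (f x) (g x))).
  apply: measurable_normc; apply: measurable_cadd => //.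
  rewrite (_ : (fun x => - _) = (fun x => -1 * dotC (f x) (g x))); last first.
    by apply/funext => x; rewrite mulN1r.
  by apply: measurable_cmul => //; exact: measurable_dotC.
rewrite (_ : (fun x => _) = (fun x => normc (1 - dotC (f x) (g x)) `^ (- beta))).
  exact: (measurableT_comp (measurable_powR (- beta)) mn).
by apply/funext => x; rewrite powRN.
Qed.

Lemma kernel_bound (beta : R) (z : Cn R d) : 0 < beta -> beta < d.+1%:R -> B z ->
  (\int[dv R d]_(w in B) ((normc (1 - dotC z w) `^ beta)^-1)%:E <=
   (Gamma d.+1%:R * Gamma (d.+1%:R - beta) / Gamma (d.+1%:R - beta / 2) ^+ 2)%:E)%E.
Proof.
move=> b0 bd z1; pose b := beta / 2.
have hb : 0 < b by rewrite /b; lra.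
have bE : beta = 2 * b by rewrite /b; field.
have mB := @measurable_unit_ball R d.
pose f N (w : Cn R d) : \bar R := (normc (binom_poly b (dotC z w) N).[1] ^+ 2)%:E.
have f0 N w : (0 <= f N w)%E by rewrite lee_fin sqr_ge0.
have mf N : measurable_fun B (f N).
  apply: measurable_funTS; apply/measurable_EFinP.
  apply: measurable_funX; apply: measurable_normc.
  rewrite (_ : (fun w => _) = (fun w => (\poly_(k < N) (binom_coef b k)%:C).[dotC z w])).
    by apply: measurable_horner; apply: measurable_dotC.
  apply/funext => w; rewrite !horner_poly.
  by apply: eq_bigr => k _; rewrite expr1n mulr1.
have lim w : B w ->
    limn_einf (f^~ w) = ((normc (1 - dotC z w) `^ beta)^-1)%:E.
  move=> w1; have := binom_poly_cvg hb (normc_dotC_lt1 z1 w1).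
  rewrite -bE => cv.
  have {}cv : f N w @[N --> \oo] --> ((normc (1 - dotC z w) `^ beta)^-1)%:E.
    by apply: cvg_EFin => //; exact: nearW.
  rewrite is_cvg_limn_einfE; first exact/cvg_lim.
  by apply/cvg_ex; eexists; exact: cv.
rewrite (eq_integral (fun w => limn_einf (f^~ w))); last first.
  by move=> w /set_mem wB; rewrite lim.
apply: le_trans (fatou _ mB mf (fun n w _ => f0 n w)) _.
(* The lower limit is the limit of the infima of the tails, and the infimum of the tail from N is at
   most the N-th integral. *)
rewrite limn_einf_lim; apply: lime_le; first exact: is_cvg_einfs.
apply: nearW => N.
apply: (@le_trans _ _ (\int[dv R d]_(w in B) f N w)%E).
  by apply: ereal_inf_lbound; exists N => /=.
apply: le_trans (integral_binom_poly _ _ z1) _.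
rewrite lee_fin -/b {1}bE; apply: gauss_sum_le_Gamma => //.
by rewrite -bE.
Qed.

End kernel_bound.

(** * The bilinear form *)

Section weighted_amgm.
Variable R : realType.

(** From 1 + y <= e^y at y = x/S - 1, raised to the power a. *)
Lemma powR_le_expR (x S a : R) : 0 <= x -> 0 < S -> 0 <= a ->
  x `^ a <= S `^ a * expR (a * (x / S - 1)).
Proof.
move=> x0 S0 a0.
have xS : x <= S * expR (x / S - 1).
  rewrite -ler_pdivrMl// mulrC.
  by have := expR_ge1Dx (x / S - 1); rewrite addrCA subrr addr0.
have e0 := expR_ge0 (x / S - 1).
apply: le_trans (ge0_ler_powR a0 _ _ xS) _; rewrite ?nnegrE ?mulr_ge0 ?(ltW S0)//.
by rewrite powRM ?(ltW S0)// [a * _]mulrC expRM.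
Qed.

(** Polya's proof: three instances of [powR_le_expR] with a common S are multiplied; the exponents
    add up to m/S - 1 <= 0. *)
Lemma weighted_amgm3 (x y z a b c : R) : 0 <= x -> 0 <= y -> 0 <= z ->
  0 <= a -> 0 <= b -> 0 <= c -> a + b + c = 1 ->
  x `^ a * y `^ b * z `^ c <= a * x + b * y + c * z.
Proof.
move=> x0 y0 z0 a0 b0 c0 abc; set m := a * x + b * y + c * z.
have m0 : 0 <= m by rewrite !addr_ge0 ?mulr_ge0.
(* S = m + e in place of m, which may be 0. *)
apply/ler_addgt0Pr => e e0; have S0 : 0 < m + e by rewrite ltr_wpDl.
apply: (@le_trans _ _ (((m + e) `^ a * expR (a * (x / (m + e) - 1))) *
   ((m + e) `^ b * expR (b * (y / (m + e) - 1))) *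
   ((m + e) `^ c * expR (c * (z / (m + e) - 1))))).
  apply: ler_pM; rewrite ?mulr_ge0 ?powR_ge0 ?powR_le_expR//.
  by apply: ler_pM; rewrite ?powR_ge0 ?powR_le_expR.
rewrite [leLHS](_ : _ = ((m + e) `^ a * (m + e) `^ b * (m + e) `^ c) *
  (expR (a * (x / (m + e) - 1)) * expR (b * (y / (m + e) - 1)) *
   expR (c * (z / (m + e) - 1)))); last by ring.
have S1 : (m + e) `^ a * (m + e) `^ b * (m + e) `^ c = m + e.
  have ne : m + e != 0 by rewrite gt_eqF.
  rewrite -powRD ?ne ?implybT// -powRD ?ne ?implybT//.
  by rewrite abc powRr1// ltW.
rewrite S1 ler_piMr ?(ltW S0)// -!expRD -[leRHS]expR0 ler_expR.
rewrite [leLHS](_ : _ = m / (m + e) - (a + b + c)); last by rewrite /m; field; rewrite gt_eqF.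
by rewrite abc subr_le0 ler_pdivrMr// mul1r lerDl ltW.
Qed.

End weighted_amgm.

Section dv_integration.
Variables (R : realType) (d : nat).
Local Notation B := (@unit_ball R d).
Local Notation Cd := (Cn R d).
Local Notation mB := (@measurable_unit_ball R d).

Lemma dv_setT : dv R d setT = 1%E.
Proof.
rewrite -(dv_unit_ball R d).
transitivity (((fine (lebesgue_Cn R d B))^-1)%:E * lebesgue_Cn R d (setT `&` B))%E => //.
transitivity (((fine (lebesgue_Cn R d B))^-1)%:E * lebesgue_Cn R d (B `&` B))%E => //.
by rewrite setTI setIid.
Qed.

(* A copy of [dv] on which a sigma-finite structure is declared, as needed by
   Tonelli's theorem. *)
Definition dv_measure : set Cd -> \bar R := dv R d.

Let dv0 : dv_measure set0 = 0%E. Proof. exact: measure0. Qed.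
Let dv_ge0 A : (0 <= dv_measure A)%E. Proof. exact: measure_ge0. Qed.
Let dv_sigma_additive : semi_sigma_additive dv_measure.
Proof. exact: measure_semi_sigma_additive. Qed.

HB.instance Definition _ :=
  isMeasure.Build _ _ _ dv_measure dv0 dv_ge0 dv_sigma_additive.

Let dv_sigma_finite : sigma_finite setT dv_measure.
Proof.
exists (fun=> setT) => [|k]; first by rewrite bigcup_const//; exists 0%N.
by split => //; rewrite /dv_measure dv_setT ltry.
Qed.

HB.instance Definition _ :=
  Measure_isSigmaFinite.Build _ _ _ dv_measure dv_sigma_finite.

Implicit Types h : Cd * Cd -> \bar R.

Lemma measurable_section1 h : measurable_fun setT h -> (forall v, 0 <= h v)%E ->
  measurable_fun setT (fun z => \int[dv R d]_(w in B) h (w, z))%E.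
Proof.
move=> mh h0.
rewrite (_ : (fun z => _) = fubini_G dv_measure h).
  exact: measurable_fun_fubini_tonelli_G.
apply/funext => z; rewrite /fubini_G -ge0_integral_dvT//.
exact: measurableT_comp mh (measurable_pair2 _).
Qed.

Lemma measurable_section2 h : measurable_fun setT h -> (forall v, 0 <= h v)%E ->
  measurable_fun setT (fun w => \int[dv R d]_(z in B) h (w, z))%E.
Proof.
move=> mh h0.
rewrite (_ : (fun w => _) = fubini_F dv_measure h).
  exact: measurable_fun_fubini_tonelli_F.
apply/funext => w; rewrite /fubini_F -ge0_integral_dvT//.
exact: measurableT_comp mh (measurable_pair1 _).
Qed.

Lemma dv_tonelli h : measurable_fun setT h -> (forall v, 0 <= h v)%E ->
  (\int[dv R d]_(z in B) \int[dv R d]_(w in B) h (w, z) =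
   \int[dv R d]_(w in B) \int[dv R d]_(z in B) h (w, z))%E.
Proof.
move=> mh h0.
rewrite -ge0_integral_dvT; last 2 first.
- exact: measurable_section1.
- by move=> z; exact: integral_ge0.
rewrite -ge0_integral_dvT; last 2 first.
- exact: measurable_section2.
- by move=> w; exact: integral_ge0.
transitivity (\int[dv_measure]_z \int[dv_measure]_w h (w, z))%E.
  apply: eq_integral => z _; rewrite -ge0_integral_dvT//.
  exact: measurableT_comp mh (measurable_pair2 _).
transitivity (\int[dv_measure]_w \int[dv_measure]_z h (w, z))%E.
  by apply/esym; exact: (@fubini_tonelli _ _ _ _ R dv_measure dv_measure h mh h0).
apply: eq_integral => w _; rewrite -ge0_integral_dvT//.
exact: measurableT_comp mh (measurable_pair1 _).
Qed.

End dv_integration.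

(** * Iterated integrals over the ball and the Schur-type estimate *)

Section bilinear_form.
Variables (R : realType) (d : nat).
Local Notation B := (@unit_ball R d).
Local Notation Cd := (Cn R d).
Local Notation mB := (@measurable_unit_ball R d).
Implicit Types h : Cd * Cd -> R.

Definition form_integral h : \bar R :=
  (\int[dv R d]_(z in B) \int[dv R d]_(w in B) (h (w, z))%:E)%E.

Lemma measurable_inner h : measurable_fun setT h -> (forall v, 0 <= h v) ->
  measurable_fun setT (fun z => \int[dv R d]_(w in B) (h (w, z))%:E)%E.
Proof.
move=> mh h0; apply: (@measurable_section1 R d (EFin \o h)).
  exact/measurable_EFinP.
by move=> v; rewrite lee_fin.
Qed.

Lemma measurable_row h z : measurable_fun setT h ->
  measurable_fun B (fun w => (h (w, z))%:E).
Proof.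
move=> mh; apply: measurable_funTS; apply/measurable_EFinP.
exact: measurableT_comp mh (measurable_pair2 _).
Qed.

Lemma form_integralD h1 h2 : measurable_fun setT h1 -> measurable_fun setT h2 ->
  (forall v, 0 <= h1 v) -> (forall v, 0 <= h2 v) ->
  form_integral (h1 \+ h2) = (form_integral h1 + form_integral h2)%E.
Proof.
move=> m1 m2 h10 h20; rewrite /form_integral -ge0_integralD//; first last.
- by apply: measurable_funTS; exact: measurable_inner.
- by move=> z _; apply: integral_ge0 => w _; rewrite lee_fin.
- by apply: measurable_funTS; exact: measurable_inner.
- by move=> z _; apply: integral_ge0 => w _; rewrite lee_fin.
- exact: mB.
apply: eq_integral => z _; rewrite -ge0_integralD//; first last.
- exact: measurable_row.
- by move=> w _; rewrite lee_fin.
- exact: measurable_row.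
- by move=> w _; rewrite lee_fin.
- exact: mB.
Qed.

Lemma form_integralZ (a : R) h : measurable_fun setT h ->
  (forall v, 0 <= h v) -> 0 <= a ->
  form_integral (fun v => a * h v) = (a%:E * form_integral h)%E.
Proof.
move=> mh h0 a0; rewrite /form_integral -ge0_integralZl//; first last.
- by move=> z _; apply: integral_ge0 => w _; rewrite lee_fin.
- by apply: measurable_funTS; exact: measurable_inner.
- exact: mB.
apply: eq_integral => z _; rewrite -ge0_integralZl//; first last.
- by move=> w _; rewrite lee_fin.
- exact: measurable_row.
- exact: mB.
Qed.

Lemma le_form_integral h1 h2 : measurable_fun setT h1 -> measurable_fun setT h2 ->
  (forall v, 0 <= h1 v) -> (forall v, 0 <= h2 v) ->
  (forall w z, B w -> B z -> h1 (w, z) <= h2 (w, z)) ->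
  (form_integral h1 <= form_integral h2)%E.
Proof.
move=> m1 m2 h10 h20 h12; apply: ge0_le_integral.
- exact: mB.
- by move=> z _; apply: integral_ge0 => w _; rewrite lee_fin.
- by apply: measurable_funTS; exact: measurable_inner.
- by apply: measurable_funTS; exact: measurable_inner.
move=> z Bz; apply: ge0_le_integral.
- exact: mB.
- by move=> w _; rewrite lee_fin.
- exact: measurable_row.
- exact: measurable_row.
by move=> w Bw; rewrite lee_fin; exact: h12.
Qed.

Lemma integral_weight_le1 (u : Cd -> R) (G : Cd -> \bar R) :
  measurable_fun setT u -> (forall z, 0 <= u z) ->
  measurable_fun setT G -> (forall z, 0 <= G z)%E ->
  (forall z, B z -> G z <= 1)%E ->
  (\int[dv R d]_(z in B) (u z)%:E <= 1)%E ->
  (\int[dv R d]_(z in B) ((u z)%:E * G z) <= 1)%E.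
Proof.
move=> mu u0 mG G0 G1; apply: le_trans; apply: ge0_le_integral.
- exact: mB.
- by move=> z _; apply: mule_ge0 => //; rewrite lee_fin.
- by apply: measurable_funTS; apply: emeasurable_funM => //; exact/measurable_EFinP.
- by apply: measurable_funTS; exact/measurable_EFinP.
by move=> z Bz; rewrite -[leRHS]mule1 lee_pmul ?lee_fin ?G1.
Qed.

Section convex_combination.
Variables (k : Cd * Cd -> R) (phi psi : Cd -> R).
Hypotheses (mk : measurable_fun setT k) (k0 : forall v, 0 <= k v).
Hypotheses (mphi : measurable_fun setT phi) (phi0 : forall w, 0 <= phi w).
Hypotheses (mpsi : measurable_fun setT psi) (psi0 : forall z, 0 <= psi z).
Hypothesis k1 : forall w, B w -> (\int[dv R d]_(z in B) (k (w, z))%:E <= 1)%E.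
Hypothesis k2 : forall z, B z -> (\int[dv R d]_(w in B) (k (w, z))%:E <= 1)%E.
Hypothesis phi1 : (\int[dv R d]_(w in B) (phi w)%:E <= 1)%E.
Hypothesis psi1 : (\int[dv R d]_(z in B) (psi z)%:E <= 1)%E.

Let mphi2 : measurable_fun setT (fun v : Cd * Cd => phi v.1).
Proof. exact: measurableT_comp mphi measurable_fst. Qed.

Let mpsi2 : measurable_fun setT (fun v : Cd * Cd => psi v.2).
Proof. exact: measurableT_comp mpsi measurable_snd. Qed.

Lemma form_integral_kernel_le1 : (form_integral k <= 1)%E.
Proof.
apply: (@le_trans _ _ (\int[dv R d]_(z in B) (cst 1 z))%E).
  apply: ge0_le_integral => //.
  - exact: mB.
  - by move=> z _; apply: integral_ge0 => w _; rewrite lee_fin.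
  - by apply: measurable_funTS; exact: measurable_inner.
by rewrite integral_cst ?mul1e ?dv_unit_ball//; exact: mB.
Qed.

Lemma form_integral_psi_le1 : (form_integral (fun v => (psi v.2 * k v)%R) <= 1)%E.
Proof.
rewrite /form_integral.
rewrite (eq_integral (fun z => (psi z)%:E * \int[dv R d]_(w in B) (k (w, z))%:E)%E).
  apply: integral_weight_le1 => //; first exact: measurable_inner.
  by move=> z; apply: integral_ge0 => w _; rewrite lee_fin.
move=> z _; rewrite -ge0_integralZl//; first last.
- by rewrite lee_fin.
- by move=> w _; rewrite lee_fin.
- exact: measurable_row.
- exact: mB.
Qed.

Lemma form_integral_phi_psi_le1 : (form_integral (fun v => (phi v.1 * psi v.2)%R) <= 1)%E.
Proof.
rewrite /form_integral.
rewrite (eq_integral (fun z => (psi z)%:E * \int[dv R d]_(w in B) (phi w)%:E)%E).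
  apply: integral_weight_le1 => //.
  by move=> z; apply: integral_ge0 => w _; rewrite lee_fin.
move=> z _; rewrite -ge0_integralZl//; first last.
- by rewrite lee_fin.
- by move=> w _; rewrite lee_fin.
- by apply: measurable_funTS; exact/measurable_EFinP.
- exact: mB.
by apply: eq_integral => w _; rewrite -EFinM mulrC.
Qed.

(** The weight depends on the inner variable w, so the order of integration is exchanged before the
    bound [k1] on the integral over z can be used. *)
Lemma form_integral_phi_le1 : (form_integral (fun v => (phi v.1 * k v)%R) <= 1)%E.
Proof.
rewrite /form_integral (@dv_tonelli R d (fun v : Cd * Cd => (phi v.1 * k v)%:E)); last 2 first.
- by apply/measurable_EFinP; exact: measurable_funM.
- by move=> v; rewrite lee_fin mulr_ge0.
rewrite (eq_integral (fun w => (phi w)%:E * \int[dv R d]_(z in B) (k (w, z))%:E)%E).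
  apply: integral_weight_le1 => //; last first.
    by move=> z; apply: integral_ge0 => w _; rewrite lee_fin.
  apply: (@measurable_section2 R d (EFin \o k)); first exact/measurable_EFinP.
  by move=> v; rewrite lee_fin.
move=> w _; rewrite -ge0_integralZl//; first last.
- by rewrite lee_fin.
- by move=> z _; rewrite lee_fin.
- apply: measurable_funTS; apply/measurable_EFinP.
  exact: measurableT_comp mk (measurable_pair1 _).
- exact: mB.
Qed.

(** Serves both cases of the theorem: case (1) takes c = 0, case (2) takes e = 0. Here phi and psi
    stand for |f|^p and |g|^s after normalization. *)
Lemma form_integral_convex_le1 (a b c e : R) : 0 <= a -> 0 <= b -> 0 <= c -> 0 <= e ->
  a + b + c + e = 1 ->
  (form_integral (fun v => a * (phi v.1 * k v) + b * (psi v.2 * k v) +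
    c * (phi v.1 * psi v.2) + e * k v)%R <= 1)%E.
Proof.
move=> a0 b0 c0 e0 abce.
have m1 : measurable_fun setT (fun v : Cd * Cd => phi v.1 * k v) by exact: measurable_funM.
have m2 : measurable_fun setT (fun v : Cd * Cd => psi v.2 * k v) by exact: measurable_funM.
have m3 : measurable_fun setT (fun v : Cd * Cd => phi v.1 * psi v.2) by exact: measurable_funM.
have p1 v : 0 <= phi v.1 * k v by rewrite mulr_ge0.
have p2 v : 0 <= psi v.2 * k v by rewrite mulr_ge0.
have p3 (v : Cd * Cd) : 0 <= phi v.1 * psi v.2 by rewrite mulr_ge0.
pose h1 (v : Cd * Cd) := a * (phi v.1 * k v).
pose h2 (v : Cd * Cd) := b * (psi v.2 * k v).
pose h3 (v : Cd * Cd) := c * (phi v.1 * psi v.2).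
pose h4 (v : Cd * Cd) := e * k v.
have mh1 : measurable_fun setT h1 by exact: measurable_funM.
have mh2 : measurable_fun setT h2 by exact: measurable_funM.
have mh3 : measurable_fun setT h3 by exact: measurable_funM.
have mh4 : measurable_fun setT h4 by exact: measurable_funM.
have h10 v : 0 <= h1 v by exact: mulr_ge0.
have h20 v : 0 <= h2 v by exact: mulr_ge0.
have h30 v : 0 <= h3 v by exact: mulr_ge0.
have h40 v : 0 <= h4 v by exact: mulr_ge0.
rewrite -[X in form_integral X]/(((h1 \+ h2) \+ h3) \+ h4).
rewrite form_integralD//; last 2 first.
- by do 2 (apply: measurable_funD => //).
- by move=> v /=; rewrite !addr_ge0.
rewrite form_integralD//; last 2 first.
- exact: measurable_funD.
- by move=> v /=; rewrite addr_ge0.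
rewrite form_integralD// !form_integralZ//.
have mono (x : R) y : 0 <= x -> (y <= 1)%E -> (x%:E * y <= x%:E)%E.
  by move=> x0 y1; rewrite -[leRHS]mule1; apply: lee_wpmul2l; rewrite ?lee_fin.
rewrite -abce !EFinD; apply: leeD; first apply: leeD; first apply: leeD.
- by apply: mono => //; exact: form_integral_phi_le1.
- by apply: mono => //; exact: form_integral_psi_le1.
- by apply: mono => //; exact: form_integral_phi_psi_le1.
- by apply: mono => //; exact: form_integral_kernel_le1.
Qed.

End convex_combination.
End bilinear_form.

(** * The triangle inequality for complex and iterated integrals *)

Section complex_integral.
Variables (R : realType) (d : nat).
Local Notation B := (@unit_ball R d).
Local Notation Cd := (Cn R d).
Local Notation mB := (@measurable_unit_ball R d).

Lemma norm_Im_le_normc (z : R[i]) : `|complex.Im z| <= normc z.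
Proof.
by case: z => p q; rewrite /= -[leLHS]sqrtr_sqr ler_wsqrtr// lerDr sqr_ge0.
Qed.

Lemma Re_Im_le_normc (x z : R[i]) :
  complex.Re x * complex.Re z + complex.Im x * complex.Im z <= normc x * normc z.
Proof.
have -> : complex.Re x * complex.Re z + complex.Im x * complex.Im z =
    complex.Re (x^* * z).
  rewrite -[x^*]/(conjc x).
  by case: x => a b; case: z => u v /=; rewrite mulNr opprK.
rewrite -(normc_conj x) -Normc.normcM.
exact: le_trans (ler_norm _) (norm_Re_le_normc _).
Qed.

(** With x the integral of h, |x|^2 is the integral of Re x Re h + Im x Im h, hence at most |x|
    times the integral of |h|; then |x| is cancelled unless it is 0. *)
Lemma normc_Cintegral_le (h : Cd -> R[i]) : measurable_fun setT h ->
  ((normc (Cintegral h))%:E <= \int[dv R d]_(z in B) (normc (h z))%:E)%E.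
Proof.
move=> mh.
have mn : measurable_fun B (fun z => (normc (h z))%:E).
  by apply: measurable_funTS; apply/measurable_EFinP; exact: measurable_normc.
have [|fin] := leP +oo%E (\int[dv R d]_(z in B) (normc (h z))%:E)%E.
  by apply: le_trans; rewrite leey.
have i_n : (dv R d).-integrable B (EFin \o (fun z => normc (h z))).
  apply/integrableP; split => //; apply: le_lt_trans fin.
  by apply: ge0_le_integral => //; [exact: mB|exact: measurableT_comp
    |move=> z _ /=; rewrite lee_fin ger0_norm// normc_ge0].
have iRe : (dv R d).-integrable B (EFin \o (fun z => complex.Re (h z))).
  apply: le_integrable i_n => //; first exact: mB.
    apply: measurable_funTS; apply/measurable_EFinP.
    exact: measurableT_comp (@measurable_Re R) mh.
  by move=> z _ /=; rewrite lee_fin (ger0_norm (normc_ge0 _)) norm_Re_le_normc.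
have iIm : (dv R d).-integrable B (EFin \o (fun z => complex.Im (h z))).
  apply: le_integrable i_n => //; first exact: mB.
    apply: measurable_funTS; apply/measurable_EFinP.
    exact: measurableT_comp (@measurable_Im R) mh.
  by move=> z _ /=; rewrite lee_fin (ger0_norm (normc_ge0 _)) norm_Im_le_normc.
set x := Cintegral h.
have xRe : complex.Re x = \int[dv R d]_(z in B) complex.Re (h z) by [].
have xIm : complex.Im x = \int[dv R d]_(z in B) complex.Im (h z) by [].
clearbody x.
rewrite -[leRHS]fineK; last exact: (integrable_fin_num mB i_n).
rewrite lee_fin -[leRHS]/(\int[dv R d]_(z in B) normc (h z)).
set N := (X in _ <= X).
have N0 : 0 <= N by apply: Rintegral_ge0 => z _; exact: normc_ge0.
have key : normc x * normc x <= normc x * N.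
  rewrite -expr2 sqr_normc_ReIm !expr2 {2}xRe {2}xIm /N.
  rewrite -(RintegralZl _ mB iRe) -(RintegralZl _ mB iIm) -(RintegralZl _ mB i_n).
  rewrite -RintegralD//; first last.
  - exact: (integrableZl mB (complex.Im x) iIm).
  - exact: (integrableZl mB (complex.Re x) iRe).
  - exact: mB.
  apply: le_Rintegral.
  - exact: mB.
  - exact: (integrableD mB (integrableZl mB (complex.Re x) iRe)
      (integrableZl mB (complex.Im x) iIm)).
  - exact: (integrableZl mB (normc x) i_n).
  - by move=> z _; exact: Re_Im_le_normc.
have := normc_ge0 x; rewrite le_eqVlt => /predU1P[<-//|x0].
by rewrite -(ler_pM2l x0).
Qed.

(** The measurability part of Tonelli's theorem is applied to the positive and negative parts;
    composing with [fine] covers the parameters where the integral is not finite. *)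
Lemma measurable_signed_inner (u : Cd * Cd -> R) : measurable_fun setT u ->
  measurable_fun setT (fun z => \int[dv R d]_(w in B) u (w, z)).
Proof.
move=> mu; have meu : measurable_fun setT (EFin \o u) by exact/measurable_EFinP.
apply: (measurableT_comp (fine_measurable measurableT)).
have mp := measurable_section1 (measurable_funepos meu) (funepos_ge0 (EFin \o u)).
have mn := measurable_section1 (measurable_funeneg meu) (funeneg_ge0 (EFin \o u)).
rewrite (_ : (fun z => _) = (fun z =>
    \int[dv R d]_(w in B) (EFin \o u)^\+ (w, z) -
    \int[dv R d]_(w in B) (EFin \o u)^\- (w, z))%E).
  exact: emeasurable_funB.
apply/funext => z; rewrite integralE.
by congr (_ - _)%E; apply: eq_integral => w _; rewrite ?funeposE ?funenegE.
Qed.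

Lemma normc_iterated_Cintegral_le (h : Cd * Cd -> R[i]) : measurable_fun setT h ->
  ((normc (Cintegral (fun z => Cintegral (fun w => h (w, z)))))%:E <=
   form_integral (fun v => normc (h v)))%E.
Proof.
move=> mh.
have mI : measurable_fun setT (fun z => Cintegral (fun w => h (w, z))).
  apply: measurable_fun_complex.
    apply: (@measurable_signed_inner (@complex.Re R \o h)).
    exact: measurableT_comp (@measurable_Re R) mh.
  apply: (@measurable_signed_inner (@complex.Im R \o h)).
  exact: measurableT_comp (@measurable_Im R) mh.
apply: le_trans (normc_Cintegral_le mI) _.
apply: ge0_le_integral.
- exact: mB.
- by move=> z _; rewrite lee_fin normc_ge0.
- by apply: measurable_funTS; apply/measurable_EFinP; exact: measurable_normc.
- apply: measurable_funTS; apply: (@measurable_inner R d (fun v => normc (h v))).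
    exact: measurable_normc.
  by move=> v; exact: normc_ge0.
move=> z _; apply: normc_Cintegral_le.
exact: measurableT_comp mh (measurable_pair2 _).
Qed.

End complex_integral.

Section admissibility.
Variables (R : realType) (d : nat).
Local Notation B := (@unit_ball R d).
Local Notation Cd := (Cn R d).
Local Notation mB := (@measurable_unit_ball R d).

Lemma normLp_ge0 (p : R) (f : Cd -> R[i]) : 0 <= normLp p f.
Proof. by rewrite /normLp fine_ge0// Lnorm_ge0. Qed.

Lemma integral_Lp (p : R) (f : Cd -> R[i]) : 0 < p -> Lp p f ->
  (\int[dv R d]_(w in B) (normc (f w) `^ p)%:E = (normLp p f `^ p)%:E)%E.
Proof.
move=> p0 [mf fin].
have mfp : measurable_fun setT (fun w => (normc (f w) `^ p)%:E).
  apply/measurable_EFinP.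
  exact: (measurableT_comp (measurable_powR p) (measurable_normc mf)).
rewrite -ge0_integral_dvT//; last by move=> w; rewrite lee_fin powR_ge0.
transitivity ('N[dv R d]_p%:E[EFin \o (@normc R \o f)] `^ p)%E.
  have pn0 : p != 0 by rewrite gt_eqF.
  rewrite (poweR_Lnorm _ _ pn0); apply: eq_integral => w _ /=.
  by rewrite ger0_norm ?normc_ge0.
by rewrite -poweR_EFin /normLp fineK// ge0_fin_numE// Lnorm_ge0.
Qed.

Lemma normc_kernel_form (alpha : R) (f g : Cd -> R[i]) w z :
  normc (kernel_form alpha f g w z) =
  normc (f w) * normc (g z) * (normc (1 - dotC z w) `^ alpha)^-1.
Proof.
rewrite /kernel_form !Normc.normcM Normc.normcV; congr (_ * _^-1).
by rewrite /= expr0n addr0 sqrtr_sqr ger0_norm ?powR_ge0.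
Qed.

Lemma measurable_kernel_form (alpha : R) (f g : Cd -> R[i]) :
  measurable_fun setT f -> measurable_fun setT g ->
  measurable_fun setT (fun v : Cd * Cd => kernel_form alpha f g v.1 v.2).
Proof.
move=> mf mg; apply: measurable_cmul.
  apply: measurable_cmul.
    exact: measurableT_comp mf measurable_fst.
  exact: measurableT_comp mg measurable_snd.
have mk : measurable_fun setT
    (fun v : Cd * Cd => (normc (1 - dotC v.2 v.1) `^ alpha)^-1).
  by apply: measurable_dotC_kernel; [exact: measurable_snd|exact: measurable_fst].
rewrite (_ : (fun v => _) = (fun v : Cd * Cd => ((normc (1 - dotC v.2 v.1) `^ alpha)^-1)%:C)).
  apply: measurable_fun_complex.
    exact: mk.
  exact: measurable_cst.
by apply/funext => v; rewrite fmorphV.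
Qed.

(* [X] and [Y] stand for [|f w|] and [|g z|], divided by numbers slightly larger
   than the norms so as to avoid dividing by zero. *)
Lemma admissible_of_pointwise (alpha p s C : R) (k : Cd * Cd -> R) (a b c e : R) :
  0 < p -> 0 < s -> 0 <= C ->
  measurable_fun setT k -> (forall v, 0 <= k v) ->
  (forall w, B w -> (\int[dv R d]_(z in B) (k (w, z))%:E <= 1)%E) ->
  (forall z, B z -> (\int[dv R d]_(w in B) (k (w, z))%:E <= 1)%E) ->
  0 <= a -> 0 <= b -> 0 <= c -> 0 <= e -> a + b + c + e = 1 ->
  (forall X Y w z, 0 <= X -> 0 <= Y -> B w -> B z ->
    X * Y * (normc (1 - dotC z w) `^ alpha)^-1 <=
    C * (a * (X `^ p * k (w, z)) + b * (Y `^ s * k (w, z)) +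
         c * (X `^ p * Y `^ s) + e * k (w, z))) ->
  admissible d alpha p s C.
Proof.
move=> p0 s0 C0 mk k0 k1 k2 a0 b0 c0 e0 abce pointwise f g Lf Lg.
have [mf _] := Lf; have [mg _] := Lg.
pose h (v : Cd * Cd) := kernel_form alpha f g v.1 v.2.
have mh : measurable_fun setT h by exact: measurable_kernel_form.
have mnh : measurable_fun setT (fun v => normc (h v)) by exact: measurable_normc.
have nh0 v : 0 <= normc (h v) by exact: normc_ge0.
have bound (eps : R) : 0 < eps -> (form_integral (fun v => normc (h v)) <=
    (C * (normLp p f + eps) * (normLp s g + eps))%:E)%E.
  move=> eps0.
  have weight q (u : Cd -> R[i]) : 0 < q -> Lp q u ->
      let phi w := (normc (u w) / (normLp q u + eps)) `^ q in
      measurable_fun setT phi /\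
      (\int[dv R d]_(w in B) (phi w)%:E <= 1)%E.
    move=> q0 Lu phi; have N0 := normLp_ge0 q u.
    have F0 : 0 < normLp q u + eps by rewrite ltr_wpDl.
    have [mu _] := Lu.
    have phiE w : phi w = ((normLp q u + eps) `^ q)^-1 * normc (u w) `^ q.
      rewrite /phi powRM ?normc_ge0 ?invr_ge0 ?(ltW F0)// mulrC; congr (_ * _).
      by rewrite -powR_inv1 ?(ltW F0)// -powRrM mulN1r powRN.
    have muq : measurable_fun setT (fun w => normc (u w) `^ q).
      exact: (measurableT_comp (measurable_powR q) (measurable_normc mu)).
    split.
      rewrite (_ : phi = fun w => ((normLp q u + eps) `^ q)^-1 * normc (u w) `^ q).
        exact: measurable_funM.
      exact/funext.
    under eq_integral do rewrite phiE EFinM.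
    rewrite ge0_integralZl//; first last.
    - by rewrite lee_fin invr_ge0 powR_ge0.
    - by move=> w _; rewrite lee_fin powR_ge0.
    - by apply: measurable_funTS; exact/measurable_EFinP.
    - exact: mB.
    rewrite (integral_Lp q0 Lu) -EFinM lee_fin ler_pdivrMl ?powR_gt0// mulr1.
    by apply: ge0_ler_powR; rewrite ?nnegrE ?(ltW q0) ?(ltW F0) ?lerDl ?(ltW eps0).
  have [mphi phi1] := weight _ _ p0 Lf; have [mpsi psi1] := weight _ _ s0 Lg.
  set F := normLp p f + eps in mphi phi1 *; set G := normLp s g + eps in mpsi psi1 *.
  have F0 : 0 < F by rewrite ltr_wpDl// normLp_ge0.
  have G0 : 0 < G by rewrite ltr_wpDl// normLp_ge0.
  have J := form_integral_convex_le1 mk k0 mphi (fun=> powR_ge0 _ _) mpsi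
    (fun=> powR_ge0 _ _) k1 k2 phi1 psi1 a0 b0 c0 e0 abce.
  move: J; set H := (X in form_integral X) => J.
  have mH : measurable_fun setT H.
    have m1 := measurableT_comp mphi (@measurable_fst _ _ Cd Cd).
    have m2 := measurableT_comp mpsi (@measurable_snd _ _ Cd Cd).
    by do 3 (apply: measurable_funD; last by do 2 apply: measurable_funM => //);
      do 2 apply: measurable_funM => //.
  have H0 v : 0 <= H v.
    by rewrite /H !addr_ge0 ?mulr_ge0 ?powR_ge0.
  have CFG : 0 <= C * F * G by rewrite !mulr_ge0 ?(ltW F0) ?(ltW G0).
  apply: (@le_trans _ _ (form_integral (fun v => C * F * G * H v))); last first.
    rewrite form_integralZ// -[leRHS]mule1; apply: lee_wpmul2l => //.
  apply: le_form_integral => //.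
  - exact: measurable_funM.
  - by move=> v; exact: mulr_ge0.
  move=> w z Bw Bz; rewrite /h normc_kernel_form /=.
  have X0 : 0 <= normc (f w) / F by rewrite divr_ge0 ?normc_ge0 ?(ltW F0).
  have Y0 : 0 <= normc (g z) / G by rewrite divr_ge0 ?normc_ge0 ?(ltW G0).
  have := pointwise _ _ _ _ X0 Y0 Bw Bz.
  rewrite -(ler_pM2l (mulr_gt0 F0 G0)).
  congr (_ <= _).
    by move: (_ `^ alpha)^-1 => q; field; rewrite !gt_eqF.
  by rewrite /H /=; ring.
have T0 : (0 <= form_integral (fun v => normc (h v)))%E.
  by apply: integral_ge0 => z _; apply: integral_ge0 => w _; rewrite lee_fin.
have Tfin : (form_integral (fun v => normc (h v)) < +oo)%E.
  by apply: le_lt_trans (bound 1 ltr01) _; rewrite ltry.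
split; first exact: Tfin.
have := normc_iterated_Cintegral_le mh.
move: bound Tfin T0; set T := form_integral _.
case: T => [t||]//; move=> bound _ _; rewrite lee_fin => /le_trans; apply.
have nf := normLp_ge0 p f; have ng := normLp_ge0 s g.
apply/ler_addgt0Pr => delta delta0.
(* For norms x, y and eps <= 1, C (x + eps) (y + eps) <= C x y + eps C (x + y + 1); the final + 1
   keeps m positive even if C = 0. *)
pose m := C * (normLp p f + normLp s g + 1) + 1.
have m0 : 0 < m by rewrite ltr_wpDl// mulr_ge0// !addr_ge0.
pose eps := Num.min 1 (delta / m).
have eps0 : 0 < eps by rewrite /eps lt_min ltr01 divr_gt0.
have eps1 : eps <= 1 by rewrite /eps ge_min lexx.
have epsm : eps * m <= delta.
  by rewrite -ler_pdivlMr// /eps ge_min lexx orbT.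
have := bound eps eps0; rewrite lee_fin => /le_trans; apply.
apply: le_trans (_ : _ <= C * normLp p f * normLp s g + eps * m) _; last first.
  by rewrite lerD2l.
rewrite /m; move: (normLp p f) (normLp s g) nf ng => x y x0 y0.
have : C * eps * eps <= C * eps * 1 by rewrite ler_wpM2l// mulr_ge0// ltW.
nra.
Qed.

End admissibility.

(** * Choice of weights and admissibility of the two constants *)

Section exponents.
Variables (R : realType) (d : nat).
Local Notation B := (@unit_ball R d).
Local Notation Cd := (Cn R d).
Implicit Types alpha beta p s : R.

(** The bound of [kernel_bound]: at beta = alpha it is the constant of (1), and its power t at beta
    = alpha/t is the constant of (2). *)
Definition kernel_sup beta : R :=
  Gamma d.+1%:R * Gamma (d.+1%:R - beta) / Gamma (d.+1%:R - beta / 2) ^+ 2.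

Lemma kernel_sup_gt0 beta : 0 < beta -> beta < d.+1%:R -> 0 < kernel_sup beta.
Proof.
move=> b0 bd; rewrite /kernel_sup divr_gt0 ?exprn_gt0 ?mulr_gt0 ?Gamma_gt0//; lra.
Qed.

Definition normalized_kernel beta (v : Cd * Cd) : R :=
  (kernel_sup beta)^-1 * (normc (1 - dotC v.2 v.1) `^ beta)^-1.

Lemma measurable_normalized_kernel beta :
  measurable_fun setT (normalized_kernel beta).
Proof.
apply: measurable_funM => //.
by apply: measurable_dotC_kernel; [exact: measurable_snd|exact: measurable_fst].
Qed.

Lemma normalized_kernel_le1 beta z : 0 < beta -> beta < d.+1%:R -> B z ->
  (\int[dv R d]_(w in B)
     ((kernel_sup beta)^-1 * (normc (1 - dotC z w) `^ beta)^-1)%:E <= 1)%E.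
Proof.
move=> b0 bd Bz; have M0 := kernel_sup_gt0 b0 bd.
under eq_integral do rewrite EFinM.
rewrite ge0_integralZl//; first last.
- by rewrite lee_fin invr_ge0 ltW.
- by move=> w _; rewrite lee_fin invr_ge0 powR_ge0.
- apply: measurable_funTS; apply/measurable_EFinP.
  by apply: measurable_dotC_kernel; [exact: measurable_cst|exact: measurable_id].
- exact: measurable_unit_ball.
apply: (@le_trans _ _ ((kernel_sup beta)^-1%:E * (kernel_sup beta)%:E)%E).
  by apply: lee_wpmul2l; [rewrite lee_fin invr_ge0 ltW|exact: kernel_bound].
by rewrite -EFinM mulVf ?gt_eqF.
Qed.

Lemma admissible_kernel_sup alpha p s : 0 < alpha -> alpha < d.+1%:R ->
  0 < p -> 0 < s -> p^-1 + s^-1 <= 1 -> admissible d alpha p s (kernel_sup alpha).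
Proof.
move=> a0 ad p0 s0 ps; have M0 := kernel_sup_gt0 a0 ad.
apply: (@admissible_of_pointwise R d alpha p s (kernel_sup alpha)
  (normalized_kernel alpha) p^-1 s^-1 0 (1 - p^-1 - s^-1)) => //.
- exact: ltW.
- exact: measurable_normalized_kernel.
- by move=> v; rewrite mulr_ge0// ?invr_ge0 ?powR_ge0// ltW.
- move=> w Bw; under eq_integral do rewrite /normalized_kernel /= dotC_swap.
  exact: normalized_kernel_le1.
- by move=> z Bz; exact: normalized_kernel_le1.
- by rewrite invr_ge0 ltW.
- by rewrite invr_ge0 ltW.
- lra.
- lra.
move=> X Y w z X0 Y0 _ _; rewrite /normalized_kernel /=.
have := powR_ge0 (normc (1 - dotC z w)) alpha; rewrite -invr_ge0.
move: (_ `^ alpha)^-1 => q q0.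
have pV0 : 0 <= p^-1 by rewrite invr_ge0 ltW.
have sV0 : 0 <= s^-1 by rewrite invr_ge0 ltW.
have e0 : 0 <= 1 - p^-1 - s^-1 by lra.
have := weighted_amgm3 (powR_ge0 X p) (powR_ge0 Y s) ler01 pV0 sV0 e0 _.
rewrite -!powRrM !mulfV ?gt_eqF// !powRr1// powR1 !mulr1 => /(_ _) H.
have {}H := H ltac:(ring).
rewrite (_ : kernel_sup alpha * _ = (p^-1 * X `^ p + s^-1 * Y `^ s + (1 - p^-1 - s^-1)) * q).
  exact: ler_wpM2r.
by move: (kernel_sup alpha) M0 => M M0; field; rewrite !gt_eqF.
Qed.

Lemma admissible_kernel_sup_pow alpha p s : 0 < alpha ->
  1 < p -> 1 < s -> 1 <= p^-1 + s^-1 ->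
  let t := 2 - p^-1 - s^-1 in alpha / t < d.+1%:R ->
  admissible d alpha p s (kernel_sup (alpha / t) `^ t).
Proof.
move=> a0 p1 s1 ps t ad.
have p0 : 0 < p by lra.
have s0 : 0 < s by lra.
have pV1 : p^-1 < 1 by rewrite invf_lt1.
have sV1 : s^-1 < 1 by rewrite invf_lt1.
have t0 : 0 < t by rewrite /t; lra.
have b0 : 0 < alpha / t by rewrite divr_gt0.
have M0 := kernel_sup_gt0 b0 ad.
have k0 v : 0 <= normalized_kernel (alpha / t) v.
  by rewrite mulr_ge0// ?invr_ge0 ?powR_ge0// ltW.
apply: (@admissible_of_pointwise R d alpha p s (kernel_sup (alpha / t) `^ t)
  (normalized_kernel (alpha / t)) (1 - s^-1) (1 - p^-1) (p^-1 + s^-1 - 1) 0) => //.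
- exact: powR_ge0.
- exact: measurable_normalized_kernel.
- move=> w Bw; under eq_integral do rewrite /normalized_kernel /= dotC_swap.
  exact: normalized_kernel_le1.
- by move=> z Bz; exact: normalized_kernel_le1.
- lra.
- lra.
- lra.
- by ring.
move=> X Y w z X0 Y0 _ _; set k := normalized_kernel _ _.
have kk0 : 0 <= k by exact: k0.
have sV0 : 0 <= 1 - s^-1 by lra.
have pV0 : 0 <= 1 - p^-1 by lra.
have c0 : 0 <= p^-1 + s^-1 - 1 by lra.
have Xp := powR_ge0 X p; have Ys := powR_ge0 Y s.
have collapse Z q r : 0 <= Z -> 0 < q -> r = q^-1 -> (Z `^ q) `^ r = Z.
  by move=> Z0 q0 ->; rewrite -powRrM mulfV ?gt_eqF// powRr1.
(* The AM-GM entries are X^p k, Y^s k and X^p Y^s; collecting powers of each variable gives X, Y and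
   k^t. Exponents may be added even for a base equal to 0, since the sums 1/p, 1/s and t are
   nonzero. *)
have XE : (X `^ p) `^ (1 - s^-1) * (X `^ p) `^ (p^-1 + s^-1 - 1) = X.
  have e : 1 - s^-1 + (p^-1 + s^-1 - 1) = p^-1 by ring.
  rewrite -powRD; last by rewrite e invr_eq0 gt_eqF.
  by rewrite e; exact: collapse.
have YE : (Y `^ s) `^ (1 - p^-1) * (Y `^ s) `^ (p^-1 + s^-1 - 1) = Y.
  have e : 1 - p^-1 + (p^-1 + s^-1 - 1) = s^-1 by ring.
  rewrite -powRD; last by rewrite e invr_eq0 gt_eqF.
  by rewrite e; exact: collapse.
have kE : k `^ (1 - s^-1) * k `^ (1 - p^-1) = k `^ t.
  have e : 1 - s^-1 + (1 - p^-1) = t by rewrite /t; ring.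
  by rewrite -powRD; [rewrite e|rewrite e gt_eqF].
(* Undoing the normalization of the kernel inside k^t costs the t-th power of [kernel_sup], the
   origin of the outer exponent in (2). *)
have ME : kernel_sup (alpha / t) `^ t * k `^ t = (normc (1 - dotC z w) `^ alpha)^-1.
  rewrite -powRM ?(ltW M0)// /k /normalized_kernel mulVKf ?gt_eqF//= -powRN -powRrM.
  by rewrite mulNr divfK ?gt_eqF// powRN.
rewrite -{}ME; clearbody k.
have := weighted_amgm3 (mulr_ge0 Xp kk0) (mulr_ge0 Ys kk0) (mulr_ge0 Xp Ys) sV0 pV0 c0 _.
rewrite mul0r addr0 => /(_ ltac:(ring)).
rewrite (powRM _ Xp kk0) (powRM _ Ys kk0) (powRM _ Xp Ys) => H.
move: H; have := powR_ge0 (kernel_sup (alpha / t)) t.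
move: (kernel_sup (alpha / t) `^ t) => m m0 /(ler_wpM2l m0); apply: le_trans.
move: (k `^ t) ((X `^ p) `^ (1 - s^-1)) ((X `^ p) `^ (p^-1 + s^-1 - 1))
  ((Y `^ s) `^ (1 - p^-1)) ((Y `^ s) `^ (p^-1 + s^-1 - 1))
  (k `^ (1 - s^-1)) (k `^ (1 - p^-1)) XE YE kE => kt A1 A2 B1 B2 K1 K2 <- <- <-.
by rewrite le_eqVlt; apply/orP; left; apply/eqP; ring.
Qed.

End exponents.

Theorem corollary6p5 (R : realType) (d : nat) (p s alpha : R)
    (d_ge1 : (1 <= d)%N) (p_gt1 : 1 < p) (s_gt1 : 1 < s)
    (alpha_gt0 : 0 < alpha) (alpha_lt : alpha < d.+1%:R)
    (exponents_le : s^-1 + p^-1 + alpha / d.+1%:R <= 2) :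
  (p^-1 < 1 - s^-1 ->
    (best_constant d alpha p s <=
      (Gamma d.+1%:R * Gamma (d.+1%:R - alpha)
        / Gamma (d.+1%:R - alpha / 2) ^+ 2)%R%:E)%E)
  /\
  (p^-1 - (1 - alpha / d.+1%:R) < 1 - s^-1 -> 1 - s^-1 <= p^-1 ->
    (best_constant d alpha p s <=
      ((Gamma d.+1%:R * Gamma (d.+1%:R - alpha / (2 - p^-1 - s^-1))
        / Gamma (d.+1%:R - alpha / (2 * (2 - p^-1 - s^-1))) ^+ 2)
          `^ (2 - p^-1 - s^-1))%R%:E)%E).
Proof.
split=> [ps|ps1 ps2]; apply: ereal_inf_lbound.
  exists (kernel_sup d alpha) => //.
  by apply: admissible_kernel_sup => //; lra.
set t := 2 - p^-1 - s^-1.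
(* The first hypothesis of (2) rearranged; it is equivalent to alpha/t < d + 1, the range of
   [kernel_bound]. The second one says 1 <= 1/p + 1/s, which makes the weight 1/p + 1/s - 1
   nonnegative. *)
have lt_t : alpha / d.+1%:R < t.
  by move: ps1; rewrite /t; move: (alpha / d.+1%:R) => q; lra.
have t0 : 0 < t by apply: lt_trans lt_t; rewrite divr_gt0.
exists (kernel_sup d (alpha / t) `^ t).
  apply: admissible_kernel_sup_pow => //; first lra.
  by rewrite -/t ltr_pdivrMr// mulrC -ltr_pdivrMr.
by rewrite /kernel_sup (_ : alpha / t / 2 = alpha / (2 * t))// invfM mulrA mulrAC.
Qed.
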